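(* Let $T$ and $T'$ be nontrivial trees. Then $\operatorname{aw}(T\square T',3)=3$ if at least one of the following holds: (a) $T$ or $T'$ is $3$-peripheral; (b) $\operatorname{diam}(T\square T')$ is even and $T$ or $T'$ is isomorphic to $P_2$; (c) $\operatorname{diam}(T\square T')$ is even and $T$ or $T'$ is weakly non-$3$-peripheral. Otherwise, $\operatorname{aw}(T\square T',3)=4$.
   Context: All graphs are finite, simple and undirected; $\mathrm{d}$ (or $\mathrm{d}_G$) denotes graph distance, $\operatorname{diam}$ the diameter, $P_n$ the path on $n$ vertices. A tree is nontrivial if it has at least two vertices. The Cartesian product $G\square H$ has vertex set $V(G)\times V(H)$, with $(x,y)$ adjacent to $(x',y')$ iff either $x=x'$ and $yy'\in E(H)$, or $y=y'$ and $xx'\in E(G)$. Colorings: an exact $r$-coloring of $G$ is a surjective function $c:V(G)\to\{1,\dots,r\}$. A $k$-term arithmetic progression ($k$-AP) in a connected graph $G$ with common difference $d$ is a list of vertices $(v_1,\dots,v_k)$ with $\mathrm{d}(v_i,v_{i+1})=d$ for $1\le i<k$. It is rainbow if its vertices all have distinct colors. The anti-van der Waerden number $\operatorname{aw}(G,k)$ is the least $r$ such that every exact $r$-coloring of $G$ contains a rainbow $k$-AP. Peripherality: a vertex $v$ of a connected graph $G$ is peripheral if its eccentricity (the maximum distance from $v$ to a vertex of $G$) equals $\operatorname{diam}(G)$. $G$ is $3$-peripheral if it contains three distinct vertices that are pairwise at distance $\operatorname{diam}(G)$; otherwise it is non-$3$-peripheral. For a tree $T$ and a peripheral vertex $v$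 of $T$, $T_{v^-}$ is the tree obtained from $T$ by deleting all vertices at distance $\operatorname{diam}(T)$ from $v$. For any vertex $u$ of $T$, $T_{u^+}$ is the tree obtained from $T$ by adding one new leaf adjacent to $u$. Let $T$ be a nontrivial non-$3$-peripheral tree. If $\operatorname{diam}(T)$ is odd, $T$ is weakly non-$3$-peripheral if $T_{v^-}$ is $3$-peripheral for every peripheral vertex $v$ of $T$. If $\operatorname{diam}(T)$ is even, $T$ is weakly non-$3$-peripheral if there exists $v\in V(T)$ such that $T_{v^+}$ is $3$-peripheral. *)

(* Defs.v *)
From HB Require Import structures.
From mathcomp Require Import all_boot.

Set Implicit Arguments.
Unset Strict Implicit.
Unset Printing Implicit Defensive.

Record sgraph := SGraph {
  svertex :> finType;
  sedge : rel svertex;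
  sedge_sym : symmetric sedge;
  sedge_irr : irreflexive sedge
}.

Notation "x -- y" := (sedge x y) (at level 30).

Section Basics.
Variable G : sgraph.
Implicit Types (x y z v : G) (n k d r : nat).

Definition walk n x y :=
  [exists p : n.-tuple G, path (@sedge G) x p && (last x p == y)].

(* A shortest walk between connected vertices has length < #|G|, so searching
   0, ..., #|G| - 1 suffices; the value is the junk #|G| if x and y are not
   connected. *)
Definition dist x y : nat := find (fun n => walk n x y) (iota 0 #|G|).

Definition ecc x := \max_(y : G) dist x y.

Definition diam := \max_(x : G) ecc x.

Definition connected := 0 < #|G| /\ forall x y, connect (@sedge G) x y.

(* [ucycle] also accepts sequences of length at most 2, which are not cycles of
   a simple graph. *)
Definition acyclic := forall c : seq G, 2 < size c -> ~ ucycle (@sedge G) c.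

Definition tree := connected /\ acyclic.

Definition nontrivial_tree := tree /\ 1 < #|G|.

Definition peripheral v := ecc v == diam.

Definition three_peripheral :=
  [exists x : G, exists y : G, exists z : G,
    [&& x != y, x != z, y != z,
        dist x y == diam, dist x z == diam & dist y z == diam]].

(* The palette {1, ..., r} is represented by 'I_r. *)
Definition exact_coloring r (c : {ffun G -> 'I_r}) :=
  [forall i : 'I_r, exists x : G, c x == i].

Definition is_AP d (s : seq G) := sorted [rel x y | dist x y == d] s.

(* Restricting the common difference to d <= diam makes the predicate decidable
   and loses nothing: d is a distance as soon as k > 1, and is irrelevant
   otherwise. *)
Definition has_rainbow_AP r (c : {ffun G -> 'I_r}) k :=
  [exists d : 'I_diam.+1, exists s : k.-tuple G, is_AP d s && uniq (map c s)].

(* The number of colors is required to be positive: r = 0 would qualify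
   vacuously. *)
Definition forces_rainbow k r :=
  (0 < r) && [forall c : {ffun G -> 'I_r},
                exact_coloring c ==> has_rainbow_AP c k].

Lemma forces_rainbow_ex k : exists r, forces_rainbow k r.
Proof.
exists #|G|.+1; apply/forallP => c; apply/implyP => /forallP surj_c.
have /subset_leq_card : 'I_#|G|.+1 \subset codom c.
  by apply/subsetP => i _; have /existsP[x /eqP <-] := surj_c i; apply: codom_f.
by rewrite card_ord => /leq_trans/(_ (leq_image_card _ _)); rewrite ltnn.
Qed.

Definition aw k : nat := ex_minn (forces_rainbow_ex k).

End Basics.

Arguments diam : clear implicits.
Arguments connected : clear implicits.
Arguments acyclic : clear implicits.
Arguments tree : clear implicits.
Arguments nontrivial_tree : clear implicits.
Arguments three_peripheral : clear implicits.
Arguments aw : clear implicits.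

Definition isomorphic (G H : sgraph) :=
  exists2 f : G -> H, bijective f & forall x y : G, (f x -- f y) = (x -- y).

Section PathGraph.
Variable n : nat.

Definition path_rel : rel 'I_n :=
  fun i j => (i.+1 == j :> nat) || (j.+1 == i :> nat).

Lemma path_rel_sym : symmetric path_rel.
Proof. by move=> i j; rewrite /path_rel orbC. Qed.

Lemma path_rel_irr : irreflexive path_rel.
Proof. by move=> i; rewrite /path_rel orbb gtn_eqF. Qed.

Definition path_graph := SGraph path_rel_sym path_rel_irr.

End PathGraph.

Section CartesianProduct.
Variables G H : sgraph.

Definition box_rel : rel (G * H) := fun u v =>
  ((u.1 == v.1) && (u.2 -- v.2)) || ((u.2 == v.2) && (u.1 -- v.1)).

Lemma box_rel_sym : symmetric box_rel.
Proof.
move=> u v; rewrite /box_rel (eq_sym u.1) (eq_sym u.2).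
by rewrite (sedge_sym u.1) (sedge_sym u.2).
Qed.

Lemma box_rel_irr : irreflexive box_rel.
Proof. by move=> u; rewrite /box_rel !sedge_irr !andbF. Qed.

Definition box := SGraph box_rel_sym box_rel_irr.

End CartesianProduct.

Section InducedSubgraph.
Variables (G : sgraph) (P : pred G).

Definition induced_rel : rel {x : G | P x} := fun u v => val u -- val v.

Lemma induced_rel_sym : symmetric induced_rel.
Proof. by move=> u v; apply: sedge_sym. Qed.

Lemma induced_rel_irr : irreflexive induced_rel.
Proof. by move=> u; apply: sedge_irr. Qed.

Definition induced := SGraph induced_rel_sym induced_rel_irr.

End InducedSubgraph.

Definition delete_farthest (T : sgraph) (v : T) :=
  induced [pred u : T | dist v u != diam T].

Section AddLeaf.
Variables (T : sgraph) (u : T).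

(* The new leaf is None. *)
Definition add_leaf_rel : rel (option T) := fun a b =>
  match a, b with
  | Some x, Some y => x -- y
  | Some x, None | None, Some x => x == u
  | None, None => false
  end.

Lemma add_leaf_rel_sym : symmetric add_leaf_rel.
Proof. by case=> [x|] [y|] //=; apply: sedge_sym. Qed.

Lemma add_leaf_rel_irr : irreflexive add_leaf_rel.
Proof. by case=> [x|] //=; apply: sedge_irr. Qed.

Definition add_leaf := SGraph add_leaf_rel_sym add_leaf_rel_irr.

End AddLeaf.

Definition weakly_non_three_peripheral (T : sgraph) :=
  [/\ nontrivial_tree T, ~~ three_peripheral T
    & if odd (diam T)
      then forall v : T, peripheral v -> three_peripheral (delete_farthest v)
      else exists v : T, three_peripheral (add_leaf v)].

Definition aw3_condition (T T' : sgraph) :=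
  [\/ three_peripheral T \/ three_peripheral T',
      ~~ odd (diam (box T T')) /\
        (isomorphic T (path_graph 2) \/ isomorphic T' (path_graph 2))
    | ~~ odd (diam (box T T')) /\
        (weakly_non_three_peripheral T \/ weakly_non_three_peripheral T')].

(* Main.v *)
Require Import Defs.
From HB Require Import structures.
From mathcomp Require Import all_boot.
From mathcomp Require Import zify.

(* The distance of the product is the sum of the two tree metrics, and all that
   is needed of a tree is that its metric satisfies the four-point condition and
   the parity condition of a bipartite graph.

   Upper bounds.  In a rainbow-free coloring every triangle with three distinct
   colors is scalene.  Take vertices b, b' of T' at minimal distance such that
   the layers T x {x}, for x between b and b', contain three colors.  Then one
   color X occurs only in layer b, another color Y only in layer b', all the
   rest has a third color Z, d(b, b') + diam T is odd, and the X and Y vertices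
   are exactly opposite peripheral vertices of T.  Such a configuration is
   impossible when T is 3-peripheral; when the total diameter is even the segment
   from b to b' can be prolonged, and the prolongation is impossible when T is
   weakly non-3-peripheral.  The case where b and b' are adjacent, and the fact
   that a layer has at most two colors, come from the same analysis of the
   products of P_2 with a tree.  A fourth color is excluded by merging X and Y.

   Lower bounds.  Color one peripheral corner red and the vertices at the
   largest odd distance from it blue. *)

Set Implicit Arguments.
Unset Strict Implicit.
Unset Printing Implicit Defensive.

(** * Tree metrics *)

Record tree_metric (V : finType) (d : V -> V -> nat) : Prop := TreeMetric {
  tm_eq0 : forall x y, (d x y == 0) = (x == y);
  tm_sym : forall x y, d x y = d y x;
  tm_tri : forall x y z, d x z <= d x y + d y z;
  tm_odd : forall x y z, odd (d x z) = odd (d x y) (+) odd (d y z);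
  tm_4pt : forall x y z w,
    d x y + d z w <= maxn (d x z + d y w) (d x w + d y z);
  tm_mid : forall x y n, n <= d x y ->
    exists2 z, d x z = n & d z y = d x y - n }.

Definition diameter (V : finType) (d : V -> V -> nat) D :=
  (forall x y, d x y <= D) /\ exists x y, d x y = D.

Definition btw (V : finType) (d : V -> V -> nat) x y z :=
  d x y + d y z == d x z.

(** [lia] sees [d x y] and [d y x] as unrelated atoms, so a symmetry equation is supplied for each
    pair first. *)
Ltac tm_lia H :=
  match type of H with tree_metric ?d =>
    repeat match goal with
    | |- context [d ?x ?y] =>
      lazymatch goal with
      | _ : d x y = d y x |- _ => fail
      | _ : d y x = d x y |- _ => fail
      | _ => pose proof (tm_sym H x y) end
    | h : context [d ?x ?y] |- _ =>
      lazymatch goal with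
      | _ : d x y = d y x |- _ => fail
      | _ : d y x = d x y |- _ => fail
      | _ => pose proof (tm_sym H x y) end
    end
  end; lia.

Section TreeMetric.
Variables (V : finType) (d : V -> V -> nat) (D : nat).
Hypotheses (dT : tree_metric d) (dD : diameter d D).

Lemma tm_refl x : d x x = 0.
Proof. by apply/eqP; rewrite (tm_eq0 dT). Qed.

Lemma tm_neq x y : x <> y -> 0 < d x y.
Proof. by move=> /eqP; rewrite -(tm_eq0 dT) lt0n. Qed.

Lemma dist_gt0_neq x y : 0 < d x y -> x <> y.
Proof. by move=> + E; rewrite E tm_refl. Qed.

Lemma btwl x y : btw d x x y.
Proof. by rewrite /btw tm_refl. Qed.

Lemma btwr x y : btw d x y y.
Proof. by rewrite /btw tm_refl addn0. Qed.

Lemma btwC x y z : btw d x y z = btw d z y x.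
Proof. by rewrite /btw !(tm_sym dT z) (tm_sym dT y x) addnC. Qed.

Lemma btw_sub x y z w : btw d x y w -> btw d x z w -> d x y <= d x z ->
  btw d x y z.
Proof.
rewrite /btw => h1 h2 h; have := tm_4pt dT x w y z.
by have := tm_tri dT x y z; tm_lia dT.
Qed.

Lemma tm_odd_eq x y z w : d x y = d z y -> odd (d x w) = odd (d z w).
Proof. by move=> h; rewrite (tm_odd dT x y) h -(tm_odd dT). Qed.

(** [tm_odd] makes d x y + d x z - d y z even, so its half is a distance along a geodesic from x to
    y; the four-point condition puts the point reached there on the other two geodesics. *)
Lemma median x y z :
  exists m, [/\ btw d x m y, btw d y m z & btw d x m z].
Proof.
have h1 := tm_tri dT x y z; have h2 := tm_tri dT x z y.
have h3 := tm_tri dT y x z; have o := tm_odd dT x y z.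
pose n := (d x y + d x z - d y z)./2.
have [|m m1 m2] := tm_mid dT (x := x) (y := y) (n := n); first by tm_lia dT.
have h4 := tm_4pt dT x y z m.
have h5 := tm_tri dT x m z; have h6 := tm_tri dT y m z.
exists m; rewrite /btw; split; tm_lia dT.
Qed.

(** Apply the four-point condition to a, b and a diametral pair x, y: d x y + d a b is at most twice
    d a b. *)
Lemma mutually_farthest a b :
  (forall p, d a p <= d a b) -> (forall p, d b p <= d a b) -> d a b = D.
Proof.
move=> ha hb; case: dD => hD [x [y xy]].
have := tm_4pt dT x y a b; have := hD a b.
by have := ha x; have := ha y; have := hb x; have := hb y; tm_lia dT.
Qed.

End TreeMetric.

(** The metric of the path on two vertices; its product with a tree is a ladder. *)
Definition bool_dist (x y : bool) : nat := x != y.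

Lemma bool_tree_metric : tree_metric bool_dist.
Proof.
rewrite /bool_dist.
split; [by do 2!case|by do 2!case|by do 3!case|by do 3!case|by do 4!case|].
move=> x y [|n] h; first by exists x; rewrite ?eqxx ?subn0.
by exists y; move: x y n h => [] [] [].
Qed.

Lemma bool_diameter : diameter bool_dist 1.
Proof. by split=> [[] []|] //; exists true, false. Qed.

(** * Rainbow-free colorings of a product *)

Definition two_colored (C : eqType) (I : Type) (f : I -> C) :=
  forall x y z, f x <> f y -> f y <> f z -> f x = f z.

Lemma two_colored_cases (C : eqType) (I : Type) (f : I -> C) x y :
  two_colored f -> f x <> f y -> forall p, f p = f x \/ f p = f y.
Proof.
move=> h xy p; case: (f p =P f y) => [->|n]; first by right.
by left; apply: (h p y x) => //; apply: nesym.
Qed.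

Section Coloring.
Variables (T U : finType) (d : T -> T -> nat) (e : U -> U -> nat).
Variables (D : nat) (C : eqType) (c : T -> U -> C).

(** A 3-AP is a triple whose middle vertex is equidistant from the ends, so the common difference
    need not be named. *)
Definition rainbow_free := forall a u a' u' a'' u'',
  d a a' + e u u' = d a' a'' + e u' u'' ->
  c a u <> c a' u' -> c a' u' <> c a'' u'' -> c a u = c a'' u''.

Definition tricolored b b' :=
  [exists p : T * U, exists q : T * U, exists r : T * U,
    [&& btw e b p.2 b', btw e b q.2 b', btw e b r.2 b',
     c p.1 p.2 != c q.1 q.2, c q.1 q.2 != c r.1 r.2 & c p.1 p.2 != c r.1 r.2]].

Definition min_tricolored b b' := tricolored b b' &&
  [forall u, forall v, (e u v < e b b') ==> ~~ tricolored u v].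

Record structured b b' (X Y Z : C) : Prop := Structured {
  st_XY : X <> Y; st_XZ : X <> Z; st_YZ : Y <> Z;
  st_l : forall a, c a b = X \/ c a b = Z;
  st_r : forall a, c a b' = Y \/ c a b' = Z;
  st_in : forall a x, btw e b x b' -> x <> b -> x <> b' -> c a x = Z;
  st_ex : exists a a', c a b = X /\ c a' b' = Y;
  st_odd : odd (D + e b b');
  st_D : forall a a', c a b = X -> c a' b' = Y -> d a a' = D;
  st_lr : forall a p, c a b = X -> d a p = D -> c p b' = Y;
  st_rl : forall a p, c a b' = Y -> d a p = D -> c p b = X }.

Hypotheses (dT : tree_metric d) (dD : diameter d D) (eT : tree_metric e).
Hypothesis rf : rainbow_free.

Lemma tricoloredP b b' : reflect
  (exists a u a' u' a'' u'', [/\ btw e b u b', btw e b u' b', btw e b u'' b' &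
    [/\ c a u <> c a' u', c a' u' <> c a'' u'' & c a u <> c a'' u'']])
  (tricolored b b').
Proof.
apply: (iffP existsP) => [[[a u]] /existsP[[a' u']] /existsP[[a'' u'']]|] /=.
  case/and5P=> h1 h2 h3 /eqP n1 /andP[/eqP n2 /eqP n3].
  by exists a, u, a', u', a'', u''.
move=> [a [u [a' [u' [a'' [u'' [h1 h2 h3 [n1 n2 n3]]]]]]]].
exists (a, u); apply/existsP; exists (a', u'); apply/existsP; exists (a'', u'').
by rewrite /= h1 h2 h3 /=; apply/and3P; split; apply/eqP.
Qed.

Lemma tricoloredC b b' : tricolored b b' -> tricolored b' b.
Proof.
move=> /tricoloredP[a [u [a' [u' [a'' [u'' [h1 h2 h3 ns]]]]]]].
by apply/tricoloredP; exists a, u, a', u', a'', u''; rewrite !(btwC eT b').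
Qed.

Lemma min_tricoloredC b b' : min_tricolored b b' -> min_tricolored b' b.
Proof. by case/andP=> /tricoloredC h m; rewrite /min_tricolored h (tm_sym eT). Qed.

Lemma min_tricolored_lt b b' u v a x a' x' a'' x'' :
  min_tricolored b b' -> e u v < e b b' ->
  btw e u x v -> btw e u x' v -> btw e u x'' v ->
  c a x <> c a' x' -> c a' x' <> c a'' x'' -> c a x = c a'' x''.
Proof.
case/andP=> _ /forallP/(_ u)/forallP/(_ v)/implyP m {}/m /tricoloredP m *.
by apply/eqP; apply: contra_notT m => /eqP n; exists a, x, a', x', a'', x''.
Qed.

Lemma tricolored_min u v : tricolored u v ->
  exists b b', min_tricolored b b' /\ e b b' <= e u v.
Proof.
move=> h; pose P (p : U * U) := tricolored p.1 p.2.
have [[b b'] /= Pb m] := @arg_minnP _ (u, v) P (fun p => e p.1 p.2) h.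
exists b, b'; split; last exact: (m (u, v)).
rewrite /min_tricolored [tricolored b b']Pb; apply/forallP=> x; apply/forallP=> y.
by apply/implyP; apply: contraL => Pxy; rewrite -leqNgt; apply: (m (x, y)).
Qed.

Lemma min_tricolored_eq b b' u v : min_tricolored b b' -> tricolored u v ->
  e u v <= e b b' -> min_tricolored u v.
Proof.
case/andP=> _ /forallP m uv le_uv; rewrite /min_tricolored uv /=.
apply/forallP=> x; apply/forallP=> y; apply/implyP=> lt_xy.
by have /forallP/(_ y)/implyP/(_ (leq_trans lt_xy le_uv)) := m x.
Qed.

Lemma structuredC b b' X Y Z : structured b b' X Y Z -> structured b' b Y X Z.
Proof.
case=> n1 n2 n3 l r i [a [a' [ea ea']]] o hD lr rl; split=> //.
- by move=> xy; apply: n1.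
- by move=> u x; rewrite (btwC eT) => /i h h1 h2; apply: h.
- by exists a', a.
- by rewrite (tm_sym eT).
- by move=> u v h1 h2; rewrite (tm_sym dT); apply: hD.
Qed.

(** Mutual farthestness forces distance D on every X-Y pair. A vertex at distance D from an X vertex
    cannot be Z in layer b', since with a Y vertex it would form a rainbow progression centered at
    that X vertex. *)
Lemma structuredI b b' X Y Z : X <> Y -> X <> Z -> Y <> Z ->
  (forall a, c a b = X \/ c a b = Z) -> (forall a, c a b' = Y \/ c a b' = Z) ->
  (forall a x, btw e b x b' -> x <> b -> x <> b' -> c a x = Z) ->
  (exists a a', c a b = X /\ c a' b' = Y) ->
  (forall a a', c a b = X -> c a' b' = Y ->
    [/\ odd (d a a' + e b b'), forall p, d a p <= d a a' &
         forall p, d a' p <= d a a']) ->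
  structured b b' X Y Z.
Proof.
move=> n1 n2 n3 l r i ex h; have [a [a' [ea ea']]] := ex.
have hD u v : c u b = X -> c v b' = Y -> d u v = D.
  by move=> eu ev; have [_ h1 h2] := h _ _ eu ev; apply: (mutually_farthest dT).
split=> //.
- by have [+ _ _] := h _ _ ea ea'; rewrite (hD _ _ ea ea').
- move=> u p eu up; case: (r p) => // ep.
  have := rf (a := a') (u := b') (a' := u) (u' := b) (a'' := p) (u'' := b').
  rewrite (tm_sym dT a') (tm_sym eT b') up (hD u a') // eu ea' ep.
  by move=> ->//; apply: nesym.
- move=> u p eu up; case: (l p) => // ep.
  have := rf (a := a) (u := b) (a' := u) (u' := b') (a'' := p) (u'' := b).
  rewrite (tm_sym dT a) (tm_sym eT b') up (tm_sym dT) (hD a u) // eu ea ep.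
  by move=> ->.
Qed.

(** The half distance h can be split between the coordinates in several ways: one step in U and the
    rest in T when d s t allows it, everything in U otherwise. *)
Lemma midpoint_inner b b' s t : 1 < e b b' -> ~~ odd (d s t + e b b') ->
  exists r w, [/\ btw e b w b', w <> b, w <> b' &
    d s r + e b w = d r t + e w b'].
Proof.
move=> L2 ev; pose h := (d s t + e b b')./2.
have h2 : h + h = d s t + e b b' by rewrite addnn /h even_halfK.
have inner w : 0 < e b w -> 0 < e w b' -> w <> b /\ w <> b'.
  by move=> h1 h3; split; [apply: nesym|]; apply: (dist_gt0_neq eT).
case: (leqP h (d s t).+1) => le.
  have [|r r1 r2] := tm_mid dT (x := s) (y := t) (n := h - 1); first lia.
  have [|w w1 w2] := tm_mid eT (x := b) (y := b') (n := 1); first lia.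
  have [||wb wb'] := inner w; [lia|lia|].
  by exists r, w; split=> //; rewrite /btw; lia.
have [|w w1 w2] := tm_mid eT (x := b) (y := b') (n := h); first lia.
have [||wb wb'] := inner w; [lia|lia|].
by exists s, w; split=> //; rewrite /btw ?(tm_refl dT); lia.
Qed.

(** By minimality there are at most two colors on the layers from b to u2, and likewise from u1 to
    b'. Both families contain layer u1, where Z is chosen, so the other two colors are pushed to
    opposite end layers. *)
Lemma structured_long b b' :
  min_tricolored b b' -> 1 < e b b' -> exists X Y Z, structured b b' X Y Z.
Proof.
move=> m L2; set L := e b b' in L2.
have [|u1 u1b u1b'] := tm_mid eT (x := b) (y := b') (n := 1); first lia.
have [|u2 u2b u2b'] := tm_mid eT (x := b) (y := b') (n := L - 1); first lia.
have [bu1 bu2] : btw e b u1 b' /\ btw e b u2 b' by rewrite /btw; lia.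
have u1nb : u1 <> b by apply: nesym; apply: (dist_gt0_neq eT); rewrite u1b.
have u1nb' : u1 <> b' by apply: (dist_gt0_neq eT); lia.
have u2nb : u2 <> b by apply: nesym; apply: (dist_gt0_neq eT); lia.
have u2nb' : u2 <> b' by apply: (dist_gt0_neq eT); lia.
have bb' : b <> b' by apply: (dist_gt0_neq eT); lia.
have [lt1 lt2] : e u1 b' < e b b' /\ e b u2 < e b b' by lia.
have far1 n : n + L = n.+1 + e u1 b' by rewrite u1b'; lia.
have far2 n : n + L = n.+1 + e b u2 by rewrite u2b; lia.
have sub2 x : btw e b x b' -> x <> b' -> btw e b x u2.
  move=> bx /(tm_neq eT) xb'; apply: (btw_sub eT (w := b')) => //.
  by move: bx; rewrite /btw u2b; lia.
have sub1 x : btw e b x b' -> x <> b -> btw e u1 x b'.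
  move=> bx /(tm_neq eT) xb; rewrite (btwC eT); apply: (btw_sub eT (w := b)).
  - by rewrite (btwC eT).
  - by rewrite (btwC eT).
  by move: bx; rewrite /btw; tm_lia eT.
have in2 a x a' x' a'' x'' : btw e b x b' -> btw e b x' b' -> btw e b x'' b' ->
    x <> b' -> x' <> b' -> x'' <> b' ->
    c a x <> c a' x' -> c a' x' <> c a'' x'' -> c a x = c a'' x''.
  move=> h h' h'' n n' n''; by apply: (min_tricolored_lt m lt2); apply: sub2.
have in1 a x a' x' a'' x'' : btw e b x b' -> btw e b x' b' -> btw e b x'' b' ->
    x <> b -> x' <> b -> x'' <> b ->
    c a x <> c a' x' -> c a' x' <> c a'' x'' -> c a x = c a'' x''.
  move=> h h' h'' n n' n''; by apply: (min_tricolored_lt m lt1); apply: sub1.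
have [/tricoloredP[a [x [a' [x' [a'' [x'' [h h' h'' [n n' n'']]]]]]]] _] := andP m.
pose Z := c a u1.
have [p [u [q [v [bu bv pZ [qZ pq]]]]]] : exists p u q v,
    [/\ btw e b u b', btw e b v b', c p u <> Z & c q v <> Z /\ c p u <> c q v].
  case: (c a x =P Z) => [aZ|]; last case: (c a' x' =P Z) => [aZ|].
  - by exists a', x', a'', x''; split=> //; [|split] => //; rewrite -aZ; apply: nesym.
  - by exists a, x, a'', x''; split=> //; split=> //; rewrite -aZ; apply: nesym.
  - by exists a, x, a', x'.
have no2 : ~ (u <> b' /\ v <> b').
  by case=> ub' vb'; apply: pq; apply: (in2 p u a u1 q v) => //; apply: nesym.
have no1 : ~ (u <> b /\ v <> b).
  by case=> ub vb; apply: pq; apply: (in1 p u a u1 q v) => //; apply: nesym.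
have [a0 [a1 [XZ YZ XY]]] :
    exists a0 a1, [/\ c a0 b <> Z, c a1 b' <> Z & c a0 b <> c a1 b'].
  case: (u =P b') => ub'; case: (u =P b) => ub; case: (v =P b') => vb';
    case: (v =P b) => vb; subst; try by [case: bb' | case: no1 | case: no2].
    by exists q, p; split=> //; apply: nesym.
  by exists p, q.
have [X eX] : exists X, c a0 b = X by exists (c a0 b).
have [Y eY] : exists Y, c a1 b' = Y by exists (c a1 b').
rewrite eX eY in XZ YZ XY.
have I2 p' x0 : btw e b x0 b' -> x0 <> b' -> c p' x0 = X \/ c p' x0 = Z.
  move=> bx xb'; case: (c p' x0 =P Z); [by right|move=> pZ'; left; rewrite -eX].
  by apply: (in2 _ _ a u1) => //; rewrite ?eX ?(btwl eT) //; apply: nesym.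
have I1 p' x0 : btw e b x0 b' -> x0 <> b -> c p' x0 = Y \/ c p' x0 = Z.
  move=> bx xb; case: (c p' x0 =P Z); [by right|move=> pZ'; left; rewrite -eY].
  by apply: (in1 _ _ a u1) => //; rewrite ?eY ?(btwr eT) //; apply: nesym.
have In p' x0 : btw e b x0 b' -> x0 <> b -> x0 <> b' -> c p' x0 = Z.
  move=> bx xb xb'; case: (I1 p' x0 bx xb) => // e1.
  by case: (I2 p' x0 bx xb') => // e2; case: XY; rewrite -e1 -e2.
exists X, Y, Z; apply: structuredI => //.
- by move=> p'; apply: I2; rewrite ?(btwl eT).
- by move=> p'; apply: I1; rewrite ?(btwr eT) //; apply: nesym.
- by exists a0, a1.
move=> s t es et; split.
(* At even distance, a midpoint in an inner layer would have color Z, between X and Y. *)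
- apply/negPn/negP=> /(midpoint_inner L2)[r [w [bw wb wb' rw]]].
  have := rf (a := s) (u := b) (a' := r) (u' := w) (a'' := t) (u'' := b') rw.
  by rewrite es et (In r w) // => h0; apply: XY; apply: h0 => //; apply: nesym.
(* If p' is farther from s than t is, some r has distance d s t + 1 from s; in layer u2 it is as far
   from (s, b) as (t, b') is, and it has color Z. *)
- move=> p'; rewrite leqNgt; apply/negP=> lt.
  have [r r1 _] := tm_mid dT lt.
  have := rf (a := t) (u := b') (a' := s) (u' := b) (a'' := r) (u'' := u2).
  rewrite es et (In r u2) // (tm_sym dT t) (tm_sym eT b') r1 -far2 => h0.
  by apply: YZ; apply: h0 => //; apply: nesym.
- move=> p'; rewrite leqNgt; apply/negP=> lt.
  have [r r1 _] := tm_mid dT lt.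
  have := rf (a := s) (u := b) (a' := t) (u' := b') (a'' := r) (u'' := u1).
  rewrite es et (In r u1) // r1 (tm_sym eT b') -far1 => h0.
  by apply: XZ; apply: h0.
Qed.

End Coloring.

Section RainbowFree.
Variables (T U : finType) (d : T -> T -> nat) (e : U -> U -> nat).
Variables (D : nat) (C : eqType) (c : T -> U -> C).
Hypotheses (dT : tree_metric d) (eT : tree_metric e).
Hypothesis rf : rainbow_free d e c.

Lemma rf_sphere a u a' u' a'' u'' :
  d a a' + e u u' = d a a'' + e u u'' -> c a u <> c a' u' ->
  c a'' u'' = c a u \/ c a'' u'' = c a' u'.
Proof.
move=> h n; case: (c a'' u'' =P c a u); [by left | move=> n'; right].
apply/esym/(rf (a' := a) (u' := u)); [|exact: nesym..].
by rewrite (tm_sym dT a') (tm_sym eT u').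
Qed.

Lemma rf_center a u a' u' a'' u'' :
  d a a' + e u u' = d a a'' + e u u'' -> c a' u' <> c a'' u'' ->
  c a u = c a' u' \/ c a u = c a'' u''.
Proof.
move=> h n; case: (c a u =P c a' u'); [by left | move=> n'].
by case: (rf_sphere h n') => [<-|e']; [right | case: n].
Qed.

(** Distinct colors would make the three distances 1 or 2, so two of them agree and the triple is a
    progression. *)
Lemma rf_close a u a' u' a'' u'' :
  d a a' + e u u' <= 2 -> d a' a'' + e u' u'' <= 2 -> d a a'' + e u u'' <= 2 ->
  c a u <> c a' u' -> c a' u' <> c a'' u'' -> c a u = c a'' u''.
Proof.
have pos x v x' v' : c x v <> c x' v' -> 0 < d x x' + e v v'.
  move=> n; rewrite lt0n addn_eq0 (tm_eq0 dT) (tm_eq0 eT).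
  by apply/negP=> /andP[/eqP ex /eqP ev]; apply: n; rewrite ex ev.
move=> l1 l2 l3 n1 n2; apply/eqP/negPn/negP=> /eqP n3.
have := pos _ _ _ _ n1; have := pos _ _ _ _ n2; have := pos _ _ _ _ n3.
move: l1 l2 l3; set r1 := d a a' + _; set r2 := d a' a'' + _.
set r3 := d a a'' + _ => l1 l2 l3 p3 p2 p1.
have : [\/ r1 = r2, r1 = r3 | r2 = r3].
  by move: r1 r2 r3 l1 l2 l3 p1 p2 p3 => [|[|[|?]]] [|[|[|?]]] [|[|[|?]]] //;
    auto using Or31, Or32, Or33.
case=> h; first by apply: n3; apply: rf h n1 n2.
  by case: (rf_sphere h n1) => h'; [apply: n3 | apply: n2].
case: (rf_center (a := a'') (u := u'') (a' := a') (u' := u') (a'' := a) (u'' := u)).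
- by rewrite (tm_sym dT _ a') (tm_sym eT _ u') (tm_sym dT _ a) (tm_sym eT _ u).
- exact: nesym.
- by move=> h'; apply: n2.
- by move=> h'; apply: n3.
Qed.

(** The far layer can be moved onto a geodesic from b to q. Seen from (a1, b), the vertices (a2, b')
    and (a2, b'') are equidistant, so the latter is X or Y; the median of b, b', b'', where a2 has
    color Z, rules out X. *)
Lemma min_tricolored_extend b b' q :
  (forall b b', min_tricolored e c b b' ->
     exists X Y Z, structured d e D c b b' X Y Z) -> 0 < D ->
  min_tricolored e c b b' -> e b q = (e b b').+1 ->
  exists2 b'', min_tricolored e c b b'' & e b b'' = e b b' /\ e b'' q = 1.
Proof.
move=> S Dpos m bq; have [X [Y [Z st]]] := S _ _ m.
have [a1 [a2 [ea1 ea2]]] := st_ex st.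
have [|b'' b1 b2] := tm_mid eT (x := b) (y := q) (n := e b b'); first lia.
have XY := st_XY st; have XZ := st_XZ st; have YZ := st_YZ st.
have dD := st_D st ea1 ea2.
have nDself a : d a a <> D by rewrite (tm_refl dT); lia.
have a2b : c a2 b = Z.
  by case: (st_l st a2) => // h; case: (nDself a2); apply: (st_D st).
have a2b'' : c a2 b'' = Y.
  have := rf_sphere (a := a1) (u := b) (a' := a2) (u' := b') (a'' := a2) (u'' := b'').
  rewrite ea1 ea2 b1; case=> // e2.
  have [w [w1 w2 w3]] := median eT b b' b''.
  have cw : c a2 w = Z.
    case: (w =P b) => [->//|wb]; case: (w =P b') => [wb'|]; last exact: (st_in st).
    case: XY; rewrite -e2 -ea2 -wb'; congr (c a2 _); apply/eqP.
    rewrite -(tm_eq0 eT) (tm_sym eT); move: w2 w3; rewrite /btw wb'; lia.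
  have := rf_center (a := a2) (u := w) (a' := a2) (u' := b') (a'' := a2) (u'' := b'').
  rewrite cw ea2 e2; case=> //; try (by apply: nesym); try by move/esym.
  move: w1 w2 w3; rewrite /btw b1 (tm_sym eT b' w); lia.
exists b''; last lia.
apply: (min_tricolored_eq m); last by rewrite b1.
apply/tricoloredP; exists a1, b, a2, b, a2, b''.
by rewrite ea1 a2b a2b'' (btwl eT) (btwr eT); split=> //; split=> //; apply: nesym.
Qed.

End RainbowFree.

(** * Products of a two-vertex path with a tree *)

Section Ladder.
Variables (U : finType) (e : U -> U -> nat) (D : nat) (C : eqType).
Variable (c : bool -> U -> C).
Hypotheses (eT : tree_metric e) (eD : diameter e D).
Hypothesis rf : rainbow_free bool_dist e c.
Let bT := bool_tree_metric.

(** Two equal or adjacent layers of a ladder have all mutual distances at most 2. *)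
Lemma ladder_tricolored_long b b' : tricolored e c b b' -> 1 < e b b'.
Proof.
move=> /tricoloredP[a [u [a' [u' [a'' [u'' [h h' h'' [n n' n'']]]]]]]].
rewrite ltnNge; apply/negP=> le1.
have close v w : btw e b v b' -> btw e b w b' -> e v w <= 1.
  rewrite /btw => /eqP hv /eqP hw; have := tm_tri eT v b w; have := tm_tri eT v b' w.
  tm_lia eT.
have close2 x v y w : btw e b v b' -> btw e b w b' -> bool_dist x y + e v w <= 2.
  by move=> hv hw; have := close v w hv hw; rewrite /bool_dist; case: (x != y); lia.
by apply: n''; apply: (rf_close bT eT rf (a' := a') (u' := u')); rewrite ?close2.
Qed.

Lemma ladder_structured_min b b' : min_tricolored e c b b' ->
  exists X Y Z, structured bool_dist e 1 c b b' X Y Z.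
Proof.
move=> m; apply: (structured_long bT bool_diameter eT rf m).
by apply: ladder_tricolored_long; case/andP: m.
Qed.

(** A layer q one step beyond the end is impossible. Comparing (x, q) with (y, b'') from (x, b) and
    from (x, b'') gives it color Y, but it is equidistant from (x, b), colored X, and (y, r),
    colored Z. *)
Lemma ladder_ecc b b' p : min_tricolored e c b b' -> e b p <= e b b'.
Proof.
move=> m0; rewrite leqNgt; apply/negP=> lt.
have [|q bq _] := tm_mid eT (x := b) (y := p) (n := (e b b').+1); first lia.
have [] := @min_tricolored_extend bool U bool_dist e 1 C c bT eT rf b b' q.
- exact: ladder_structured_min.
- by [].
- exact: m0.
- by [].
move=> b'' m [bb'' b''q]; rewrite -{}bb'' in bq.
have L2 : 1 < e b b'' by apply: ladder_tricolored_long; case/andP: m.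
have [X [Y [Z st]]] := ladder_structured_min m.
have [x [y [ex ey]]] := st_ex st; have xy := st_D st ex ey.
have XY := st_XY st; have XZ := st_XZ st; have YZ := st_YZ st.
have xb'' : c x b'' = Z.
  case: (st_r st x) => // h; have := st_D st ex h.
  by rewrite (tm_refl bT).
have xq : c x q = Y.
  have := rf_sphere bT eT rf
    (a := x) (u := b) (a' := y) (u' := b'') (a'' := x) (u'' := q).
  have := rf_sphere bT eT rf
    (a := x) (u := b'') (a' := y) (u' := b'') (a'' := x) (u'' := q).
  rewrite ex ey xb'' xy bq b''q !(tm_refl bT) (tm_refl eT) => h1 h2.
  case: h1 => //; try by apply: nesym.
  by move=> e1; case: h2; rewrite ?e1 ?add1n //; try congruence.
have [|r r1 r2] := tm_mid eT (x := b) (y := b'') (n := 1); first lia.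
have yr : c y r = Z.
  apply: (st_in st).
  - by rewrite /btw; lia.
  - by apply: nesym; apply: (dist_gt0_neq eT); lia.
  - by apply: (dist_gt0_neq eT); lia.
have qr : e q r = e b b''.
  have := tm_tri eT b r q; have := tm_tri eT r b'' q; tm_lia eT.
have := rf_sphere bT eT rf
  (a := x) (u := q) (a' := x) (u' := b) (a'' := y) (u'' := r).
rewrite xy qr (tm_sym eT q) bq (tm_refl bT) xq ex yr.
by case; rewrite ?add1n //; try congruence.
Qed.

(** A minimal pair realizes the diameter by mutual farthestness, so every tricolored pair does and
    is itself minimal. *)
Lemma ladder_structured b b' : tricolored e c b b' ->
  e b b' = D /\ exists X Y Z, structured bool_dist e 1 c b b' X Y Z.
Proof.
move=> t; have [u [v [m le]]] := tricolored_min t.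
have uv : e u v = D.
  apply: (mutually_farthest eT eD) => p; first exact: ladder_ecc.
  by rewrite (tm_sym eT u); apply: ladder_ecc; apply: min_tricoloredC.
have bb' : e b b' = D by apply/eqP; rewrite eqn_leq eD.1 -uv.
split=> //; apply: ladder_structured_min; apply: (min_tricolored_eq m t).
by rewrite bb' uv.
Qed.

End Ladder.

(** * Layers in a product of two trees *)

Section TwoTrees.
Variables (T U : finType) (d : T -> T -> nat) (e : U -> U -> nat).
Variables (D E : nat) (C : eqType) (c : T -> U -> C).
Hypotheses (dT : tree_metric d) (dD : diameter d D) (Dpos : 0 < D).
Hypotheses (eT : tree_metric e) (eE : diameter e E) (Epos : 0 < E).
Hypothesis rf : rainbow_free d e c.

(** For adjacent b and b', these two layers viewed as a ladder over T. *)
Definition rung (b b' : U) (x : bool) (a : T) := c a (if x then b else b').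

Lemma rung_rainbow_free b b' : e b b' = 1 -> rainbow_free bool_dist d (rung b b').
Proof.
move=> bb' x a x' a' x'' a'' h; apply: rf; move: h; rewrite ![bool_dist _ _ + _]addnC.
have ee y y' : e (if y then b else b') (if y' then b else b') = bool_dist y y'.
  by case: y y' => [] []; rewrite ?(tm_refl eT) // (tm_sym eT).
by rewrite !ee.
Qed.

Lemma neighbor u : exists u', e u u' = 1.
Proof.
have [_ [x [y xy]]] := eE.
suff [v uv] : exists v, 0 < e u v.
  by have [w h _] := tm_mid eT uv; exists w.
have := tm_tri eT x u y; case: (posnP (e u x)) => [|h]; last by exists x.
by exists y; tm_lia eT.
Qed.

(** In the ladder on u and a neighbor, the inner vertex m has the dominant color. This leaves X and
    Y for a and a' on the same side, whereas X and Y vertices lie on opposite sides. *)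
Lemma fiber_btw u a m a' : btw d a m a' ->
  c a u <> c m u -> c m u <> c a' u -> c a u = c a' u.
Proof.
move=> am n1 n2; apply/eqP/negPn/negP=> /eqP n3.
have [u' uu'] := neighbor u.
have [|_ [X [Y [Z st]]]] := ladder_structured dT dD (rung_rainbow_free uu')
  (b := a) (b' := a').
  apply/tricoloredP; exists true, a, true, m, true, a'.
  by rewrite am (btwl dT) (btwr dT).
have em : c m u = Z.
  by apply: (st_in st true am) => h; [case: n1 | case: n2]; rewrite h.
have := st_D st (a := true) (a' := true).
case: (st_l st true) => /= [->|]; last by rewrite /rung -em.
case: (st_r st true) => /= [->|]; last by rewrite /rung -em => /esym.
by move=> h; have := h erefl erefl.
Qed.

(** Of three vertices with distinct colors, two differ in color from their median, which lies
    between them. *)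
Lemma fiber_two_colored u : two_colored (c^~ u).
Proof.
move=> x y z n1 n2; apply/eqP/negPn/negP=> /eqP n3.
have [m [h1 h2 h3]] := median dT x y z.
case: (c m u =P c x u) => [mx|nx].
  by apply: n2; apply: (fiber_btw h2); rewrite mx //; apply: nesym.
case: (c m u =P c y u) => [my|ny].
  by apply: n3; apply: (fiber_btw h3); rewrite my.
by apply: n1; apply: (fiber_btw h1) => //; apply: nesym.
Qed.

Lemma tricolored_edge b b' : e b b' = 1 -> tricolored e c b b' ->
  exists a a', tricolored d (rung b b') a a'.
Proof.
move=> bb' tb.
suff: [exists a, exists a', tricolored d (rung b b') a a'].
  by move=> /existsP[a /existsP[a' h]]; exists a, a'.
apply: contraT => no.
have lad x y z s t a a' a'' : btw d s a t -> btw d s a' t -> btw d s a'' t ->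
    rung b b' x a <> rung b b' y a' -> rung b b' y a' <> rung b b' z a'' ->
    rung b b' x a = rung b b' z a''.
  move=> h h' h'' n1 n2; apply/eqP/negPn/negP=> /eqP n3; case/negP: no.
  apply/existsP; exists s; apply/existsP; exists t; apply/tricoloredP.
  by exists x, a, y, a', z, a''.
have fib x a a' a'' : rung b b' x a <> rung b b' x a' ->
    rung b b' x a' <> rung b b' x a'' -> rung b b' x a = rung b b' x a''.
  exact: fiber_two_colored.
(* The copy of a3 in layer x differs in color from the copy across, since a layer has at most two
   colors; it also differs from a1 or a2, and the segment from that vertex to a3 shows three
   colors. *)
have H x a1 a2 a3 : rung b b' x a1 <> rung b b' x a2 ->
    rung b b' x a2 <> rung b b' (~~ x) a3 ->
    rung b b' x a1 = rung b b' (~~ x) a3.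
  move=> n1 n2; apply/eqP/negPn/negP=> /eqP n3.
  have := lad x x (~~ x) a1 a3 a1 a3 a3; have := lad x x (~~ x) a2 a3 a2 a3 a3.
  rewrite !(btwl dT) !(btwr dT) => h1 h2; have := fib x a1 a2 a3.
  case: (rung b b' x a3 =P rung b b' (~~ x) a3) => [->|n4].
    by move=> /(_ n1 n2).
  case: (rung b b' x a2 =P rung b b' x a3) => [e4|n5].
    by move=> _; apply: n3; apply: h2 => //; rewrite -e4.
  by move=> _; apply: n2; apply: h1.
move/tricoloredP: tb => [a1 [x1 [a2 [x2 [a3 [x3 [h1 h2 h3 [n1 n2 n3]]]]]]]].
have end_ x : btw e b x b' -> exists y, x = if y then b else b'.
  rewrite /btw bb'; case: (e b x =P 0) => [/eqP|].
    by rewrite (tm_eq0 eT) => /eqP <-; exists true.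
  move=> h1' h2'; have : e x b' == 0 by lia.
  by rewrite (tm_eq0 eT) => /eqP ->; exists false.
have [y1 E1] := end_ _ h1; have [y2 E2] := end_ _ h2; have [y3 E3] := end_ _ h3.
have : [/\ rung b b' y1 a1 <> rung b b' y2 a2, rung b b' y2 a2 <> rung b b' y3 a3
  & rung b b' y1 a1 <> rung b b' y3 a3] by rewrite /rung -E1 -E2 -E3.
move=> {E1 E2 E3 h1 h2 h3 n1 n2 n3} [n1 n2 n3].
(* Two of the three vertices share a layer, and [H] applies to them and the third. *)
case: (y1 =P y2) => [e12|n12].
  case: (y3 =P y1) => [e13|n13]; first by subst; case: n3; apply: fib n1 n2.
  have e3 : y3 = ~~ y1 by case: (y1) (y3) n13 => [] [].
  by subst; case: n3; apply: H n1 n2.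
case: (y3 =P y1) => [e13|n13].
  have e2 : y2 = ~~ y1 by case: (y1) (y2) n12 => [] [].
  by subst; case: n1; apply: (H _ _ a3) => //; apply: nesym.
have e23 : y3 = y2 by case: (y1) (y2) (y3) n12 n13 => [] [] [].
have e1 : y1 = ~~ y2 by case: (y1) (y2) n12 => [] [].
by subst; case: n1; apply/esym/(H _ _ a3) => //; apply: nesym.
Qed.

(** The ladder on b and b' supplies X and Y, two-colored layers extend this to all of T, and the
    ladder result for each X-Y pair v, w gives d v w = D and the parity. *)
Lemma structured_edge b b' : e b b' = 1 -> tricolored e c b b' ->
  exists X Y Z, structured d e D c b b' X Y Z.
Proof.
move=> bb' tb; have [a [a' ta]] := tricolored_edge bb' tb.
have R := rung_rainbow_free bb'.
have [_ [X0 [Y0 [Z0 st0]]]] := ladder_structured dT dD R ta.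
have [s [s' [X [Y [Z [st es es']]]]]] : exists s s' X Y Z,
    [/\ structured bool_dist d 1 (rung b b') s s' X Y Z,
     rung b b' true s = X & rung b b' false s' = Y].
  have [x [y [ex ey]]] := st_ex st0; have := st_D st0 ex ey.
  case: x y ex ey => [] [] // ex ey _; first by exists a, a', X0, Y0, Z0.
  exists a', a, Y0, X0, Z0; split=> //.
  exact: (structuredC bool_tree_metric dT st0).
have XY := st_XY st; have XZ := st_XZ st; have YZ := st_YZ st.
have eZ : c s b' = Z.
  case: (st_l st false) => // h; by have := st_D st h es'.
have eZ' : c s' b = Z.
  case: (st_r st true) => // h; by have := st_D st es h.
rewrite /rung in es es'.
have l v : c v b = X \/ c v b = Z.
  by rewrite -es -eZ'; apply: (two_colored_cases (@fiber_two_colored b));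
    rewrite es eZ'.
have r v : c v b' = Y \/ c v b' = Z.
  by rewrite -es' -eZ; apply: (two_colored_cases (@fiber_two_colored b'));
    rewrite es' eZ.
exists X, Y, Z; apply: (structuredI dT dD eT rf) => //.
- move=> v u; rewrite /btw bb' => h ub ub'.
  have := tm_neq eT ub; have := tm_neq eT ub'; tm_lia eT.
- by exists s, s'.
move=> v w ev ew.
(* If v were X and Y in the two layers, the ladder segment from v to s' would have Y dominant, and X
   and Z on the same side. *)
have ev' : c v b' = Z.
  case: (r v) => // evY.
  have [|_ [X' [Y' [Z' st']]]] := ladder_structured dT dD R (b := v) (b' := s').
    apply/tricoloredP; exists true, v, false, v, true, s'.
    rewrite (btwl dT) (btwr dT) /rung ev evY eZ'; split=> //; split=> //.
  have := st_D st' (a := true) (a' := true).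
  have := st_l st' true; have := st_l st' false; have := st_r st' true.
  have := st_r st' false; rewrite /rung ev evY eZ' es'.
  have := st_XY st'; have := st_XZ st'; have := st_YZ st'.
  rewrite /bool_dist /= => k1 k2 k3 k4 k5 k6 k7 k8.
  have : 0 = 1 by apply: k8; intuition congruence.
  by [].
have [|vw [X' [Y' [Z' st']]]] := ladder_structured dT dD R (b := v) (b' := w).
  apply/tricoloredP; exists true, v, false, v, false, w.
  rewrite (btwl dT) (btwr dT) /rung ev ev' ew; split=> //; split=> //.
  exact: nesym.
by have := st_odd st'; rewrite vw bb' addnC; split=> //; apply: dD.1.
Qed.

Lemma structured_of_min b b' : min_tricolored e c b b' ->
  exists X Y Z, structured d e D c b b' X Y Z.
Proof.
move=> m; have tb : tricolored e c b b' by case/andP: m.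
case: (ltngtP 1 (e b b')) => [lt|lt|/esym bb']; last exact: structured_edge.
  exact: (structured_long dT dD eT rf m).
have eq_b v : btw e b v b' -> v = b.
  by rewrite /btw => h; apply/esym/eqP; rewrite -(tm_eq0 eT); lia.
move/tricoloredP: tb => [a1 [x1 [a2 [x2 [a3 [x3 [h1 h2 h3 [n1 n2 n3]]]]]]]].
move: n1 n2 n3; rewrite (eq_b _ h1) (eq_b _ h2) (eq_b _ h3) => n1 n2 n3.
by case: n3; apply: fiber_two_colored n1 n2.
Qed.

Definition three_colors :=
  exists p q r : T * U, [/\ c p.1 p.2 <> c q.1 q.2, c q.1 q.2 <> c r.1 r.2
                         & c p.1 p.2 <> c r.1 r.2].

(** With m the median of the three layers, two of the three vertices differ in color from (a1, m),
    and m lies between their layers. *)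
Lemma structured_exists : three_colors ->
  exists b b' X Y Z, min_tricolored e c b b' /\ structured d e D c b b' X Y Z.
Proof.
move=> [[a1 x1] [[a2 x2] [[a3 x3] /= [n1 n2 n3]]]].
suff [u [v uv]] : exists u v, tricolored e c u v.
  have [b [b' [m _]]] := tricolored_min uv.
  by have [X [Y [Z st]]] := structured_of_min m; exists b, b', X, Y, Z.
have [m [h1 h2 h3]] := median eT x1 x2 x3.
have tri u a v a' : btw e u m v -> c a u <> c a' v -> c a1 m <> c a u ->
    c a1 m <> c a' v -> exists u v, tricolored e c u v.
  move=> h k1 k2 k3; exists u, v; apply/tricoloredP; exists a, u, a1, m, a', v.
  rewrite h (btwl eT) (btwr eT); split=> //; split=> //; exact: nesym.
case: (c a1 m =P c a1 x1) => [e1|m1].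
  by apply: (tri _ a2 _ a3 h2); rewrite ?e1.
case: (c a1 m =P c a2 x2) => [e2|m2].
  by apply: (tri _ a1 _ a3 h3); rewrite ?e2 //; apply: nesym.
exact: (tri _ a1 _ a2 h1).
Qed.

End TwoTrees.

(** * Excluding three colors *)

Definition three_far (V : finType) (d : V -> V -> nat) D :=
  exists x y z, [/\ d x y = D, d x z = D & d y z = D].

(* If a has color X in layer b and its opposite end has color Y in layer b',
   then w has color X or Y in the layer just beyond b'; the vertex z rules out Y
   and the midpoint p rules out X. *)
Definition spread (V : finType) (d : V -> V -> nat) D a b := exists w z p,
  [/\ d a w + 1 = D, d w z + 1 = D, d z b < D & d a p < D /\ d p w + 1 = d p b].

Section ThreeColors.
Variables (T U : finType) (d : T -> T -> nat) (e : U -> U -> nat).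
Variables (D E : nat) (C : eqType) (c : T -> U -> C).
Hypotheses (dT : tree_metric d) (dD : diameter d D) (Dpos : 0 < D).
Hypotheses (eT : tree_metric e) (eE : diameter e E) (Epos : 0 < E).
Hypothesis rf : rainbow_free d e c.
Hypothesis c3 : three_colors c.

(** By the four-point condition, two of the three points are at distance D from an X vertex. Both
    are Y in layer b', and since they are opposite to each other one is also X in layer b, at
    distance 0 from a Y vertex. *)
Lemma three_far_two_colors : ~ three_far d D.
Proof.
have [b [b' [X [Y [Z [_ st]]]]]] := structured_exists dT dD Dpos eT eE Epos rf c3.
have [a [a' [ea ea']]] := st_ex st; have aa' := st_D st ea ea'.
move=> [x [y [z [xy xz yz]]]].
have bd u : d a u < D \/ d a u = D by have := dD.1 a u; lia.
have [p [q [ap aq pq]]] : exists p q, [/\ d a p = D, d a q = D & d p q = D].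
  have h1 := tm_4pt dT x y a a'; have h2 := tm_4pt dT x z a a'.
  have h3 := tm_4pt dT y z a a'; have := dD.1 x a'; have := dD.1 y a'.
  have := dD.1 z a' => l1 l2 l3; case: (bd x) => bx.
    by exists y, z; split=> //; case: (bd y) => by_; case: (bd z) => bz; tm_lia dT.
  case: (bd y) => by_; last by exists x, y.
  by exists x, z; split=> //; case: (bd z) => bz; tm_lia dT.
have pb' := st_lr st ea ap; have qb' := st_lr st ea aq.
have := st_D st (st_rl st pb' pq) qb'; rewrite (tm_refl dT); lia.
Qed.

Hypothesis even_DE : ~~ odd (D + E).

Lemma diameter_neq1 : E <> 1.
Proof.
have [b [b' [X [Y [Z [_ st]]]]]] := structured_exists dT dD Dpos eT eE Epos rf c3.
move=> E1; have o := st_odd st; have le := eE.1 b b'.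
have [a [a' [ea _]]] := st_ex st.
have : 0 < e b b'.
  apply: (tm_neq eT) => bb'; have := st_XY st; have := st_XZ st.
  by case: (st_r st a); rewrite -bb' ea.
move: even_DE; lia.
Qed.

Lemma spread_extend b b' q : (forall a a', d a a' = D -> spread d D a a') ->
  min_tricolored e c b b' -> e b q <> (e b b').+1.
Proof.
move=> sp m0 bq0.
have S := structured_of_min dT dD Dpos eT eE Epos rf.
have [b'' m [bb'' b''q]] := min_tricolored_extend dT eT rf S Dpos m0 bq0.
have {m0 bb''} bq : e b q = (e b b'').+1 by rewrite bb''.
have [X [Y [Z st]]] := S _ _ m.
have [a1 [a2 [ea1 ea2]]] := st_ex st; have a12 := st_D st ea1 ea2.
have [w [z [p [aw wz za [ap pw]]]]] := sp _ _ a12.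
have XY := st_XY st; have XZ := st_XZ st; have YZ := st_YZ st.
have wq : c w q = X \/ c w q = Y.
  rewrite -ea1 -ea2; apply: (rf_sphere dT eT rf); [lia | congruence].
case: wq => wq.
(* (p, b'') is equidistant from (w, q) and (a2, b''), but its layer has no X and p is too close to
   a1 for Y. *)
- have pb : c p b'' = X \/ c p b'' = Y.
    rewrite -wq -ea2; apply: (rf_center dT eT rf); last congruence.
    by rewrite (tm_refl eT); lia.
  have pY : c p b'' = Y by case: pb => // h; case: (st_r st p) => // h'; congruence.
  by have := st_D st ea1 pY; lia.
(* (z, b) and (a1, b) are equidistant from (w, q), which forces X on z although z is too close to
   a2. *)
- have zb : c z b = Y \/ c z b = X.
    rewrite -wq -ea1; apply: (rf_sphere dT eT rf); last congruence.
    rewrite (tm_sym dT w) (tm_sym eT q); lia.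
  have zX : c z b = X by case: zb => // h; case: (st_l st z) => // h'; congruence.
  by have := st_D st zX ea2; lia.
Qed.

(** No layer lies beyond either end of a minimal segment, so its length is E, and [st_odd]
    contradicts the parity of D + E. *)
Lemma not_spread : ~ forall a a', d a a' = D -> spread d D a a'.
Proof.
have [b [b' [X [Y [Z [m st]]]]]] := structured_exists dT dD Dpos eT eE Epos rf c3.
move=> sp; have o := st_odd st.
have far u u' : min_tricolored e c u u' -> forall p, e u p <= e u u'.
  move=> m' p; rewrite leqNgt; apply/negP=> lt.
  have [|q uq _] := tm_mid eT (x := u) (y := p) (n := (e u u').+1); first lia.
  by apply: (spread_extend (q := q) sp m').
have : e b b' = E.
  apply: (mutually_farthest eT eE); first exact: far.
  by move=> p; rewrite (tm_sym eT b); apply/far/min_tricoloredC.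
by move: o even_DE => + + h; rewrite h => ->.
Qed.

End ThreeColors.

(** * Excluding a fourth color *)

Lemma rainbow_free_swap (T U : finType) (d : T -> T -> nat) (e : U -> U -> nat)
    (C : eqType) (c : T -> U -> C) :
  rainbow_free d e c -> rainbow_free e d (fun u a => c a u).
Proof. by move=> rf u a u' a' u'' a'' h; apply: rf; rewrite addnC h addnC. Qed.

Section FourColors.
Variables (T U : finType) (d : T -> T -> nat) (e : U -> U -> nat).
Variables (D E : nat) (C : finType) (c : T -> U -> C).
Hypotheses (dT : tree_metric d) (dD : diameter d D) (Dpos : 0 < D).
Hypotheses (eT : tree_metric e) (eE : diameter e E) (Epos : 0 < E).
Hypothesis rf : rainbow_free d e c.

Lemma two_colored_eq_or I (f : I -> C) x y z (P Q R : C) : two_colored f ->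
  f x = P -> f y = Q -> P <> Q -> f z = R -> R = P \/ R = Q.
Proof.
by move=> h <- <- n <-; apply: (two_colored_cases h n).
Qed.

(* A fourth color W only occurs at non-peripheral first coordinates and in
   layers colored by Z and W.  After merging X and Y it would have to be the
   dominant color, yet one of the two end layers then contains X or Y. *)
Lemma no_four_colors : #|C| = 4 -> ~ forall k, exists a u, c a u = k.
Proof.
move=> C4 onto.
have F := fiber_two_colored dT dD Dpos eT eE Epos rf.
have F' := fiber_two_colored eT eE Epos dT dD Dpos (rainbow_free_swap rf).
have c3 : three_colors c.
  have /card_gt2P[k1 [k2 [k3 [_ [/eqP n1 /eqP n2 /eqP n3]]]]] : 2 < #|C| by rewrite C4.
  have [[a1 [u1 e1]] [a2 [u2 e2]] [a3 [u3 e3]]] := And3 (onto k1) (onto k2) (onto k3).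
  exists (a1, u1), (a2, u2), (a3, u3); rewrite /= e1 e2 e3.
  by split=> //; apply: nesym.
have [b [b' [X [Y [Z [_ st]]]]]] := structured_exists dT dD Dpos eT eE Epos rf c3.
have XY := st_XY st; have XZ := st_XZ st; have YZ := st_YZ st.
have [a1 [a2 [ea1 ea2]]] := st_ex st; have a12 := st_D st ea1 ea2.
have small (s : seq C) : uniq s -> size s <= 4.
  by move=> /card_uniqP <-; rewrite -C4; apply: max_card.
have [W [WX WY WZ]] : exists W, [/\ W <> X, W <> Y & W <> Z].
  have /card_gt0P[W] : 0 < #|predC (mem [:: X; Y; Z])|.
    rewrite -(ltn_add2l #|mem [:: X; Y; Z]|) addn0 cardC C4.
    by rewrite ltnS; apply: leq_trans (card_size [:: X; Y; Z]).
  rewrite !inE !negb_or => /and3P[/eqP ? /eqP ? /eqP ?]; by exists W.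
have all4 k : [\/ k = X, k = Y, k = Z | k = W].
  case: (k =P X) => [|n1]; first by constructor 1.
  case: (k =P Y) => [|n2]; first by constructor 2.
  case: (k =P Z) => [|n3]; first by constructor 3.
  case: (k =P W) => [|n4]; first by constructor 4.
  have /small : uniq [:: k; W; X; Y; Z]; last by [].
  rewrite /= !inE !negb_or.
  by move: n1 n2 n3 n4 WX WY WZ XY XZ YZ; do 10!move/eqP=> ->.
have a1b' : c a1 b' = Z.
  by case: (st_r st a1) => // h; have := st_D st ea1 h; rewrite (tm_refl dT); lia.
have a2b : c a2 b = Z.
  by case: (st_l st a2) => // h; have := st_D st h ea2; rewrite (tm_refl dT); lia.
(* In layer t, a1 is X or Z and a2 is Y or Z; X at a1 would give a third color beside W. *)
have layer s t a : c s t = W -> c a t = W \/ c a t = Z.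
  move=> st_; suff a1t : c a1 t = Z.
    by have := two_colored_eq_or (F t) (x := s) (y := a1) (z := a) st_ a1t WZ erefl.
  have k1 := two_colored_eq_or (F' a1) (x := b) (y := b') (z := t) ea1 a1b' XZ erefl.
  have k2 := two_colored_eq_or (F' a2) (x := b') (y := b) (z := t) ea2 a2b YZ erefl.
  case: k1 => // k1.
  by have [] := two_colored_eq_or (F t) (x := s) (y := a1) (z := a2) st_ k1 WX erefl;
    case: k2; congruence.
have column s t u : c s t = W -> c s u = W \/ c s u = Z.
  move=> st_; suff sb : c s b = Z.
    by have := two_colored_eq_or (F' s) (x := t) (y := b) (z := u) st_ sb WZ erefl.
  case: (st_l st s) => // k1.
  by have [] := two_colored_eq_or (F' s) (x := t) (y := b) (z := b') st_ k1 WX erefl;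
    case: (st_r st s); congruence.
(* By the four-point condition, an opposite of s would make s opposite to a1 or a2, hence put X or Y
   in the column of s. *)
have inner s t p : c s t = W -> d s p <> D.
  move=> st_ sp; have n1 : d s a1 <> D.
    rewrite (tm_sym dT) => h; have := st_lr st ea1 h.
    by have [] := column _ _ b' st_; congruence.
  have n2 : d s a2 <> D.
    rewrite (tm_sym dT) => h; have := st_rl st ea2 h.
    by have [] := column _ _ b st_; congruence.
  have := tm_4pt dT s p a1 a2; have := dD.1 s a1; have := dD.1 s a2.
  have := dD.1 p a1; have := dD.1 p a2; lia.
pose h k := if k == Y then X else k.
have hE k : k <> Y -> h k = k by rewrite /h; case: eqP.
have hW k : h k = W -> k = W.
  by rewrite /h; case: eqP => [_ /esym|//].
have hX k : h k = X -> k = X \/ k = Y.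
  by rewrite /h; case: eqP => [|_]; [right | left].
have hXZW k : [\/ h k = X, h k = Z | h k = W].
  rewrite /h; case: eqP => [_|n]; first by constructor 1.
  by case: (all4 k) => // ->; [constructor 1 | constructor 2 | constructor 3].
have rfh : rainbow_free d e (fun a u => h (c a u)).
  move=> a u a' u' a'' u'' l n1 n2; rewrite (rf l) //.
    by move=> E1; apply: n1; rewrite E1.
  by move=> E1; apply: n2; rewrite E1.
have [s [t stW]] := onto W.
have c3h : three_colors (fun a u => h (c a u)).
  exists (a1, b), (a2, b), (s, t); rewrite /= ea1 a2b stW.
  rewrite !hE //; last exact: nesym.
  by split=> //; apply: nesym.
have [u [u' [X' [Y' [Z' [_ st']]]]]] :=
  structured_exists dT dD Dpos eT eE Epos rfh c3h.
have XY' := st_XY st'; have XZ' := st_XZ st'; have YZ' := st_YZ st'.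
have [r [r' [er er']]] := st_ex st'; have rr' := st_D st' er er'.
have X'W : X' <> W by rewrite -er => /hW/inner/(_ rr').
have Y'W : Y' <> W by rewrite -er' => /hW k; apply: (inner _ _ r k); rewrite (tm_sym dT).
have eru' : h (c r u') = Z'.
  by case: (st_r st' r) => // k; have := st_D st' er k; rewrite (tm_refl dT); lia.
have er'u : h (c r' u) = Z'.
  by case: (st_l st' r') => // k; have := st_D st' k er'; rewrite (tm_refl dT); lia.
have kX := hXZW (c r u); have kY := hXZW (c r' u'); have kZ := hXZW (c r u').
rewrite er in kX; rewrite er' in kY; rewrite eru' in kZ.
(* X' and Y' sit at peripheral coordinates, so neither is W. Thus W is Z' and occurs in both end
   layers, one of which also contains X or Y. *)
have Z'W : Z' = W by case: kX; case: kY; case: kZ; congruence.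
have [X'X|Y'X] : X' = X \/ Y' = X.
  by case: kX; case: kY; intuition congruence.
- have := layer _ _ r (hW _ (etrans er'u Z'W)).
  by have := hX _ (etrans er X'X); intuition congruence.
- have := layer _ _ r' (hW _ (etrans eru' Z'W)).
  by have := hX _ (etrans er' Y'X); intuition congruence.
Qed.

End FourColors.

(** * Rainbow-free colorings with three colors *)

Section TwoEnds.
Variables (V : finType) (d : V -> V -> nat) (D : nat) (a b : V).
Hypotheses (dT : tree_metric d) (dD : forall x y, d x y <= D).
Hypotheses (ab : d a b = D).

Lemma opposite_ends x y : ~ three_far d D ->
  d x b = D -> d y a = D -> d x y = D.
Proof.
move=> no xb ya; have [xa|xa] := eqVneq (d x a) D.
  by case: no; exists x, a, b.
have := tm_4pt dT x b y a; have := dD x y; have := dD x a; have := dD y b.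
tm_lia dT.
Qed.

Lemma opposite_ends_max x y : ~ three_far d D ->
  d x b = D -> d x y = D -> d y a = D.
Proof.
move=> no xb xy; have [xa|xa] := eqVneq (d x a) D.
  by case: no; exists x, a, b.
have := tm_4pt dT x y a b; have := dD y a; have := dD x a; have := dD y b; tm_lia dT.
Qed.

(** Every end x opposite to b sees the same vertices at distance D - 1 as a does, and none of these
    is peripheral. [not_weakly_tight] finds such a and b in the trees that need the even
    coloring. *)
Definition tight := forall x, d x b = D ->
  d x a + 2 <= D /\ forall y, d x y + 1 = D -> d y b + 2 <= D.

Hypothesis ti : tight.

Lemma tight_gt1 : 1 < D.
Proof. by have [+ _] := ti ab; rewrite (tm_refl dT). Qed.

(** Among two points of such a triple, one is opposite to b and the other to a; the third would then
    be opposite to both, against the first bound. *)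
Lemma tight_not_three_far : ~ three_far d D.
Proof.
have pick u v w : d u v = D -> d u w = D -> d v w = D -> d u b = D ->
    d v a = D -> False.
  move=> uv uw vw ub va; have [+ _] := ti ub.
  have nv : d v b <> D by move=> /ti [+ _]; lia.
  have := tm_4pt dT u w a b; have := tm_4pt dT v w a b.
  have nw : d w b = D -> d w a + 2 <= D by move=> /ti [].
  have := dD w a; have := dD w b; have := dD v b.
  tm_lia dT.
move=> [x [y [z [xy xz yz]]]].
have := tm_4pt dT x y a b; rewrite xy ab => h.
have := dD x a; have := dD x b; have := dD y a; have := dD y b => l1 l2 l3 l4.
have [[xb ya]|[yb xa]] : (d x b = D /\ d y a = D) \/ (d y b = D /\ d x a = D).
- by lia.
- exact: (pick x y z).
- by apply: (pick y x z) => //; rewrite (tm_sym dT).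
Qed.

(** The four-point condition gives at least D - 1, and d x y has the parity of d a y because x and a
    are equidistant from b. *)
Lemma tight_penultimate x y : d x b = D -> d a y + 1 = D -> d x y + 1 = D.
Proof.
move=> xb ay; have [xa h] := ti xb; have [_ /(_ _ ay) yb] := ti ab.
have lo : D <= d x y + 1 by have := tm_4pt dT x b a y; tm_lia dT.
have := dD x y; have : odd (d x y) = odd (d a y).
  by apply: (tm_odd_eq dT (y := b)); rewrite xb.
by move: lo ay; clear; lia.
Qed.

Lemma tight_penultimateV x y : d x b = D -> d x y + 1 = D -> d a y + 1 = D.
Proof.
move=> xb xy; have [xa /(_ _ xy) yb] := ti xb.
have lo : D <= d a y + 1 by have := tm_4pt dT x y a b; tm_lia dT.
have := dD a y; have : odd (d x y) = odd (d a y).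
  by apply: (tm_odd_eq dT (y := b)); rewrite xb.
by move: lo xy; clear; lia.
Qed.

Lemma tight_penultimate_ecc x p : d a x + 1 = D -> d x p + 1 <= D.
Proof.
move=> ax; have [_ /(_ _ ax) xb] := ti ab.
have := tm_4pt dT x p a b; have := dD p a; have := dD p b; have := dD x p => l0 l1 l2 h.
have [/tight_penultimate/(_ ax) h'|npb] := eqVneq (d p b) D.
  tm_lia dT.
tm_lia dT.
Qed.

Lemma tight_penultimate_max x p : d a x + 1 = D -> d x p + 1 = D -> d p b = D.
Proof.
move=> ax xp; have [_ /(_ _ ax) xb] := ti ab.
have := tm_4pt dT x p a b; have := dD p a; have := dD p b; tm_lia dT.
Qed.

End TwoEnds.

(** * Explicit three-colorings of the product *)

Section Colorings.
Variables (T U : finType) (d : T -> T -> nat) (e : U -> U -> nat) (D E : nat).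
Hypotheses (dT : tree_metric d) (dD : diameter d D) (Dpos : 0 < D).
Hypotheses (eT : tree_metric e) (eE : diameter e E) (Epos : 0 < E).

(** The rest gets the third color. By bipartiteness the ends of a progression are at even distance,
    so they are not R and B, which are at odd distance k. If the middle is R and one end B, the
    common difference is k and the other end is B too; likewise with R and B exchanged. *)
Lemma rainbow_free_two_sets (R B : T -> U -> bool) k : odd k ->
  (forall a u a' u', R a u -> B a' u' -> d a a' + e u u' = k) ->
  (forall a u a' u', R a u -> d a a' + e u u' = k -> B a' u') ->
  (forall a u a' u', B a u -> d a a' + e u u' = k -> R a' u') ->
  (exists a u, R a u) -> (exists a u, B a u) -> (exists a u, ~~ R a u && ~~ B a u) ->
  exists2 c : T -> U -> 'I_3, rainbow_free d e c & forall i, exists a u, c a u = i.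
Proof.
move=> ok RB Rk Bk [r [r' hr]] [b [b' hb]] [w [w' /andP[wR wB]]].
have dis a u : R a u -> B a u -> False.
  by move=> /RB h /h; rewrite (tm_refl dT) (tm_refl eT) => k0; rewrite -k0 in ok.
pose c a u : 'I_3 := if R a u then inord 0 else if B a u then inord 1 else inord 2.
exists c; last first.
  case=> [[|[|[|//]]]] i3.
  - by exists r, r'; rewrite /c hr; apply: val_inj; rewrite /= inordK.
  - exists b, b'; rewrite /c hb; case: ifP => [/dis/(_ hb)//|_].
    by apply: val_inj; rewrite /= inordK.
  - exists w, w'; rewrite /c (negbTE wR) (negbTE wB).
    by apply: val_inj; rewrite /= inordK.
have RB' a u a' u' : B a u -> R a' u' -> d a a' + e u u' = k.
  by move=> h h'; rewrite (tm_sym dT) (tm_sym eT); apply: RB.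
move=> a u a' u' a'' u'' h; rewrite /c.
have p : odd (d a a'' + e u u'') = odd (d a a' + e u u') (+) odd (d a' a'' + e u' u'').
  by rewrite !oddD (tm_odd dT a a') (tm_odd eT u u') addbACA.
rewrite h addbb in p.
have sym : d a' a + e u' u = d a' a'' + e u' u''.
  by rewrite -h (tm_sym dT a) (tm_sym eT u).
have F1 : ~~ (R a u && B a'' u'').
  by apply/negP=> /andP[h1 h2]; move: p; rewrite (RB _ _ _ _ h1 h2) ok.
have F2 : ~~ (B a u && R a'' u'').
  by apply/negP=> /andP[h1 h2]; move: p; rewrite (RB' _ _ _ _ h1 h2) ok.
have F3 : R a' u' ==> (B a'' u'' == B a u).
  apply/implyP=> h1; apply/eqP; apply/idP/idP=> h2; apply: (Rk _ _ _ _ h1).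
    by rewrite sym; apply: RB.
  by rewrite -sym; apply: RB.
have F4 : B a' u' ==> (R a'' u'' == R a u).
  apply/implyP=> h1; apply/eqP; apply/idP/idP=> h2; apply: (Bk _ _ _ _ h1).
    by rewrite sym; apply: RB'.
  by rewrite -sym; apply: RB'.
move: F1 F2 F3 F4 (@dis a u) (@dis a' u') (@dis a'' u'').
case: (R a u); case: (B a u); case: (R a' u'); case: (B a' u');
  case: (R a'' u''); case: (B a'' u'') => //= _ _ _ _ d1 d2 d3;
  try by case: d1; try by case: d2; try by case: d3.
all: try by []; try by move=> []; try by move=> _ [].
Qed.

Definition rainbow_free_onto3 :=
  exists2 c : T -> U -> 'I_3, rainbow_free d e c & forall i, exists a u, c a u = i.

(** R consists of the corners opposite to (b, w) and B of those opposite to (a, v); k is the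
    diameter of the product. *)
Lemma coloring_odd : odd (D + E) -> ~ three_far d D -> ~ three_far e E ->
  rainbow_free_onto3.
Proof.
move=> o nT nU; have [dm [a [b ab]]] := dD; have [em [v [w vw]]] := eE.
have ba : d b a = D by rewrite (tm_sym dT).
have wv : e w v = E by rewrite (tm_sym eT).
apply: (@rainbow_free_two_sets (fun x u => (d x b == D) && (e u w == E))
  (fun x u => (d x a == D) && (e u v == E)) (D + E)) => //.
- move=> x u x' u' /andP[/eqP h1 /eqP h2] /andP[/eqP h1' /eqP h2'].
  by rewrite (opposite_ends dT dm ab) // (opposite_ends eT em vw).
- move=> x u x' u' /andP[/eqP h1 /eqP h2] h.
  have [h3 h4] : d x x' = D /\ e u u' = E by have := dm x x'; have := em u u'; lia.
  by rewrite (opposite_ends_max dT dm ab nT h1) // (opposite_ends_max eT em vw nU h2) ?eqxx.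
- move=> x u x' u' /andP[/eqP h1 /eqP h2] h.
  have [h3 h4] : d x x' = D /\ e u u' = E by have := dm x x'; have := em u u'; lia.
  by rewrite (opposite_ends_max dT dm ba nT h1) // (opposite_ends_max eT em wv nU h2) ?eqxx.
- by exists a, v; rewrite ab vw !eqxx.
- by exists b, w; rewrite ba wv !eqxx.
- by exists a, w; rewrite (tm_refl dT) (tm_refl eT); lia.
Qed.

(* Red is the corner (a, v), and blue everything at distance D + E - 1 from it. *)
Lemma coloring_even a b v w : d a b = D -> e v w = E -> ~~ odd (D + E) ->
  tight d D a b -> tight e E v w -> rainbow_free_onto3.
Proof.
move=> ab vw o tT tU; have dm := dD.1; have em := eE.1.
have D1 := tight_gt1 dT ab tT; have E1 := tight_gt1 eT vw tU.
have nT := tight_not_three_far dT dm ab tT; have nU := tight_not_three_far eT em vw tU.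
have ba : d b a = D by rewrite (tm_sym dT).
have wv : e w v = E by rewrite (tm_sym eT).
(* Distance D + E - 1 splits only as D + (E - 1) or (D - 1) + E, whence the two parts of the blue
   set. *)
apply: (@rainbow_free_two_sets (fun x u => (d x b == D) && (e u w == E))
  (fun x u => (d x a == D) && (e v u + 1 == E) || (d a x + 1 == D) && (e u v == E))
  (D + E - 1)); first lia.
- move=> x u x' u' /andP[/eqP h1 /eqP h2] /orP[] /andP[/eqP h1' /eqP h2'].
    have := opposite_ends dT dm ab nT h1 h1'.
    by have := tight_penultimate eT em vw tU h2 h2'; lia.
  have := opposite_ends eT em vw nU h2 h2'.
  by have := tight_penultimate dT dm ab tT h1 h1'; lia.
- move=> x u x' u' /andP[/eqP h1 /eqP h2] h.
  have [[h3 h4]|[h3 h4]] : (d x x' = D /\ e u u' + 1 = E) \/ (d x x' + 1 = D /\ e u u' = E).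
  + by have := dm x x'; have := em u u'; lia.
  + rewrite (opposite_ends_max dT dm ab nT h1 h3).
    by rewrite (tight_penultimateV eT em vw tU h2 h4) !eqxx.
  + rewrite (opposite_ends_max eT em vw nU h2 h4).
    by rewrite (tight_penultimateV dT dm ab tT h1 h3) !eqxx orbT.
- move=> x u x' u' /orP[] /andP[/eqP h1 /eqP h2] h.
    have l := tight_penultimate_ecc eT em vw tU u' h2.
    have [h3 h4] : d x x' = D /\ e u u' + 1 = E by have := dm x x'; lia.
    rewrite (opposite_ends_max dT dm ba nT h1 h3).
    by rewrite (tight_penultimate_max eT em vw tU h2 h4) !eqxx.
  have l := tight_penultimate_ecc dT dm ab tT x' h1.
  have [h3 h4] : d x x' + 1 = D /\ e u u' = E by have := em u u'; lia.
  rewrite (opposite_ends_max eT em wv nU h2 h4).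
  by rewrite (tight_penultimate_max dT dm ab tT h1 h3) !eqxx.
- by exists a, v; rewrite ab vw !eqxx.
- have [|u h _] := tm_mid eT (x := v) (y := w) (n := E - 1); first lia.
  by exists b, u; rewrite ba h; lia.
(* 1 < D keeps (a, w) out of the second part of the blue set. *)
- by exists a, w; rewrite !(tm_refl dT) !(tm_refl eT); lia.
Qed.

End Colorings.

(** * Distances in trees and their products *)

Section GraphDistance.
Variable G : sgraph.
Implicit Types (x y z v : G) (p q : seq G).

Lemma walkP n x y :
  reflect (exists p, [/\ size p = n, path (@sedge G) x p & last x p = y]) (walk n x y).
Proof.
apply: (iffP existsP) => [[p /andP[pp /eqP lp]]|[p [sp pp lp]]].
  by exists p; rewrite size_tuple.
by exists (Tuple (introT eqP sp)); rewrite /= pp lp eqxx.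
Qed.

(** The default #|G| bounds every value of [dist], so a path shorter than [dist] would fall in the
    searched range. *)
Lemma dist_le_size x p : path (@sedge G) x p -> dist x (last x p) <= size p.
Proof.
move=> pp; rewrite leqNgt; apply/negP=> lt.
have lt' : size p < #|G|.
  by apply: leq_trans lt _; rewrite -[X in _ <= X](size_iota 0) find_size.
have := before_find 0 lt; rewrite nth_iota // add0n /= => /negbT/negP; apply.
by apply/walkP; exists p.
Qed.

Lemma geodesic_path x y : connect (@sedge G) x y ->
  exists p, [/\ path (@sedge G) x p, last x p = y, size p = dist x y & uniq (x :: p)].
Proof.
move=> xy; have hasw : has (fun n => walk n x y) (iota 0 #|G|).
  have /connectP[p pp ->] := xy; case/shortenP: pp => q pq uq _.
  apply/hasP; exists (size q); last by apply/walkP; exists q.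
  by rewrite mem_iota /= add0n -[(size q).+1]/(size (x :: q)) -(card_uniqP uq) max_card.
have := nth_find 0 hasw; rewrite nth_iota; last first.
  by rewrite -[X in _ < X](size_iota 0) -has_find.
rewrite add0n => /walkP[p [sp pp lp]]; move: lp; case/shortenP: pp sp => q pq uq sub sp lq.
exists q; split=> //; apply/eqP; rewrite eqn_leq -{2}lq dist_le_size // andbT.
rewrite /dist -sp; apply: uniq_leq_size => //.
  by case/andP: uq.
Qed.

(** Descending along f builds a path of length f x, and the edge bound excludes shorter ones.
    Distances in products, convex subgraphs and leaf extensions are computed this way, together with
    connectedness. *)
Lemma dist_eq (f : G -> nat) y : f y = 0 -> (forall x, f x = 0 -> x = y) ->
  (forall x x', x -- x' -> f x <= (f x').+1) ->
  (forall x, 0 < f x -> exists2 x', x -- x' & (f x').+1 = f x) ->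
  forall x, connect (@sedge G) x y /\ dist x y = f x.
Proof.
move=> fy f0 lip desc x.
have [p [pp lp sp]] : exists p, [/\ path (@sedge G) x p, last x p = y & size p = f x].
  move: {2}(f x) (erefl (f x)) => n; elim: n x => [|n IH] x fx.
    by exists [::]; rewrite (f0 x fx) fy.
  have [|x' xx' fx'] := desc x; first by rewrite fx.
  have [|p [pp lp sp]] := IH x'; first by lia.
  by exists (x' :: p); rewrite /= xx' pp lp sp fx'.
have cxy : connect (@sedge G) x y by apply/connectP; exists p.
split=> //; apply/eqP; rewrite eqn_leq -{1}lp -{1}sp dist_le_size //=.
have [q [pq lq <- _]] := geodesic_path cxy.
have : f x <= size q + f (last x q).
  elim: q x pq {lp lq sp pp cxy} => [|z q IH] x //= /andP[xz /IH h].
  by apply: leq_trans (lip _ _ xz) _; rewrite addSn ltnS.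
by rewrite lq fy addn0.
Qed.

Hypothesis conG : forall x y, connect (@sedge G) x y.

Lemma dist_refl x : dist x x = 0.
Proof. by have := @dist_le_size x [::] isT; rewrite leqn0 => /eqP. Qed.

Lemma dist0_eq x y : dist x y = 0 -> x = y.
Proof. by have [[|z p] [_ <- <- _]] := geodesic_path (conG x y). Qed.

Lemma dist_triangle x y z : dist x z <= dist x y + dist y z.
Proof.
have [p [pp lp <- _]] := geodesic_path (conG x y).
have [q [pq lq <- _]] := geodesic_path (conG y z).
have := @dist_le_size x (p ++ q); rewrite cat_path last_cat size_cat lp lq; apply.
by rewrite pp pq.
Qed.

Lemma dist_sym x y : dist x y = dist y x.
Proof.
suff le x' y' : dist x' y' <= dist y' x' by apply/eqP; rewrite eqn_leq !le.
have [p [pp lp <- _]] := geodesic_path (conG y' x').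
have := @dist_le_size x' (rev (belast y' p)); rewrite size_rev size_belast -lp rev_path.
rewrite -(eq_path (e := @sedge G)); last by move=> u v; rewrite (sedge_sym u).
move/(_ pp); suff -> : last (last y' p) (rev (belast y' p)) = y' by [].
by case: (p) => //= u s; rewrite rev_cons last_rcons.
Qed.

Lemma dist_edge x y : x -- y -> dist x y <= 1.
Proof. by move=> xy; apply: (@dist_le_size x [:: y]); rewrite /= xy. Qed.

Lemma dist_edge_le x y z : x -- y -> dist x z <= (dist y z).+1.
Proof.
by move=> /dist_edge xy; have := dist_triangle x y z; lia.
Qed.

Lemma dist_step x y : 0 < dist x y -> exists2 x', x -- x' & (dist x' y).+1 = dist x y.
Proof.
have [[|x' p] /= [pp lp sp _]] := geodesic_path (conG x y); first by rewrite -sp.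
case/andP: pp => xx' pp _; exists x' => //.
by have := dist_edge_le y xx'; have := dist_le_size pp; rewrite lp; lia.
Qed.

Lemma dist_prefix x y n : n <= dist x y ->
  exists2 z, dist x z = n & dist z y = dist x y - n.
Proof.
elim: n => [|n IH] lt; first by exists x; rewrite ?dist_refl ?subn0.
have [z xz zy] := IH (ltnW lt); have [|z' zz' z'y] := @dist_step z y; first lia.
exists z'; last lia.
have := dist_triangle x z' y; have := dist_triangle x z z'; have := dist_edge zz'; lia.
Qed.

End GraphDistance.

(** * Unique paths, parity and the four-point condition in trees *)

Section Tree.
Variable G : sgraph.
Hypothesis treeG : tree G.
Implicit Types (x y z v : G) (p q : seq G).

Let conG : forall x y : G, connect (@sedge G) x y.
Proof. by case: treeG => [[]]. Qed.

(** After the common prefix, the first vertex w of the second path that lies on the first closes a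
    cycle: out along p to w and back along q. *)
Lemma uniq_path_eq x p q : path (@sedge G) x p -> path (@sedge G) x q ->
  uniq (x :: p) -> uniq (x :: q) -> last x p = last x q -> p = q.
Proof.
elim: p x q => [|y p IH] x [|z q] //.
- by move=> _ _ _ /andP[+ _] /= l; rewrite l mem_last.
- by move=> _ _ /andP[+ _] _ /= l; rewrite -l mem_last.
move=> pp pq up uq l; have [yz|yz] := eqVneq y z.
  subst z; congr (_ :: _); apply: (IH y) => //.
  - by case/andP: pp.
  - by case/andP: pq.
  - by case/andP: up.
  - by case/andP: uq.
exfalso; have has_l : has (mem (y :: p)) (z :: q).
  apply/hasP; exists (last z q); first exact: mem_last.
  by move: l => /= <-; apply: mem_last.
have [w [s1 [s2 [def_q wp no1]]]] : exists w s1 s2,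
    [/\ z :: q = rcons s1 w ++ s2, w \in y :: p & ~~ has (mem (y :: p)) s1].
  by case/split_find: has_l => w s1 s2 wp no1; exists w, s1, s2.
have [p1 [p2 def_p]] : exists p1 p2, y :: p = rcons p1 w ++ p2.
  by case/path.splitP: wp => p1 p2; exists p1, p2.
have [_ acy] := treeG; apply: (acy (x :: rcons p1 w ++ rev s1)).
  (* Otherwise both paths would start with w and would not diverge. *)
  have : 0 < size p1 + size s1; last by rewrite /= size_cat size_rcons size_rev; lia.
  rewrite lt0n addn_eq0 !size_eq0; apply/negP=> /andP[/eqP p10 /eqP s10].
  by case/eqP: yz; move: def_p def_q; rewrite p10 s10 /= => [[-> _] [-> _]].
rewrite def_p cat_path last_rcons in pp; rewrite def_q cat_path last_rcons in pq.
case/andP: pp => pp1 _; case/andP: pq => pq1 _.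
rewrite def_p in up no1; rewrite def_q in uq.
apply/andP; split.
  rewrite /= rcons_cat cat_path pp1 last_rcons /=.
  have := rev_path (@sedge G) x (rcons s1 w).
  rewrite last_rcons belast_rcons rev_cons => ->.
  by rewrite (eq_path (e' := @sedge G)) // => u v; rewrite (sedge_sym u).
move: up uq; rewrite /= !mem_cat !negb_or cat_uniq => /and3P[/andP[xp _] up _].
move=> /andP[/andP[+ _]]; rewrite cat_uniq => + /and3P[+ _ _].
rewrite !mem_rcons !inE !negb_or !rcons_uniq => /andP[_ xs] /andP[_ us].
rewrite mem_rcons inE negb_or in xp; rewrite xp mem_rev xs cat_uniq up rev_uniq us /= andbT.
apply: contra no1 => /hasP[u]; rewrite mem_rev => us1 up1; apply/hasP; exists u => //.
by rewrite inE mem_cat up1.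
Qed.

(** A shortest path from x to such a neighbor avoids v, so appending v yields a simple path from x
    to v, and that is unique. *)
Lemma parent_unique (x v p q : G) : v -- p -> v -- q ->
  dist x p <= dist x v -> dist x q <= dist x v -> p = q.
Proof.
have ext r : v -- r -> dist x r <= dist x v -> exists s,
    [/\ path (@sedge G) x (rcons s v), uniq (x :: rcons s v) & last x s = r].
  move=> vr le; have [s [ps ls ss us]] := geodesic_path (conG x r).
  exists s; split=> //; first by rewrite rcons_path ps ls sedge_sym.
  rewrite -rcons_cons rcons_uniq us andbT; apply/negP=> vs.
  have : dist x v < size s; last by rewrite ss ltnNge le.
  have [s1 [s2 [def_s l1]]] : exists s1 s2, s = s1 ++ s2 /\ last x s1 = v.
    by case/splitPl: vs => s1 s2 l1; exists s1, s2.
  move: ps ls; rewrite def_s cat_path last_cat l1 size_cat => /andP[ps1 _].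
  have := dist_le_size ps1; rewrite l1; case: s2 {def_s} => [|? ?] /= h l2.
    by rewrite -l2 sedge_irr in vr.
  by rewrite addnS ltnS (leq_trans h) ?leq_addr.
move=> /ext h1 /ext h2 /h1[s [ps us ls]] /h2[t [pt ut lt]].
have /rcons_inj[st] : rcons s v = rcons t v.
  by apply: (uniq_path_eq ps pt us ut); rewrite !last_rcons.
by rewrite -ls -lt st.
Qed.

Lemma dist_edge_neq (x v p : G) : v -- p -> dist v x != dist p x.
Proof.
move=> vp; apply/negP=> /eqP eq_d.
case: (posnP (dist v x)) => [v0|/(dist_step conG)[q vq qv]].
  have pv : p = v by rewrite (dist0_eq conG v0); apply: (dist0_eq conG); rewrite -eq_d.
  by rewrite pv sedge_irr in vp.
have : p = q by apply: (@parent_unique x v) => //; rewrite !(dist_sym conG x); lia.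
by move=> pq; rewrite -pq in qv; lia.
Qed.

Lemma dist_edge_odd (x v p : G) : v -- p -> odd (dist v x) = ~~ odd (dist p x).
Proof.
move=> vp; have /eqP := dist_edge_neq x vp; have := dist_edge_le conG x vp.
by rewrite sedge_sym in vp; have := dist_edge_le conG x vp; lia.
Qed.

Lemma dist_odd x y z : odd (dist x z) = odd (dist x y) (+) odd (dist y z).
Proof.
move: {2}(dist x y) (erefl (dist x y)) => n; elim: n x => [|n IH] x xy.
  by rewrite xy (dist0_eq conG xy).
have [|x' xx' x'y] := dist_step conG (x := x) (y := y); first by rewrite xy.
rewrite (dist_edge_odd z xx') (dist_edge_odd y xx') IH; last by lia.
by case: odd; case: odd.
Qed.

(** Once a step of the geodesic from x to y moves away from z, every later step does, by
    [parent_unique] seen from z. *)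
Lemma dist_away x x1 y z : x -- x1 -> (dist x1 y).+1 = dist x y ->
  dist x z < dist x1 z -> dist y z = dist y x + dist x z.
Proof.
move=> xx1 x1y away.
suff : dist y z = dist y x1 + dist x1 z.
  have := dist_edge_le conG z xx1; rewrite sedge_sym in xx1.
  have := dist_edge_le conG z xx1; rewrite !(dist_sym conG y); lia.
move: {2}(dist x1 y) (erefl (dist x1 y)) => n.
elim: n x x1 xx1 x1y away => [|n IH] x x1 xx1 x1y away x1n.
  by rewrite -(dist0_eq conG x1n) dist_refl.
have [|x2 x12 x2y] := dist_step conG (x := x1) (y := y); first by rewrite x1n.
have lt : dist x1 z < dist x2 z.
  rewrite ltnNge; apply/negP=> le.
  have : x = x2; last by move=> xx2; rewrite -xx2 in x2y; lia.
  apply: (@parent_unique z x1) => //; first by rewrite sedge_sym.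
    by rewrite !(dist_sym conG z) ltnW.
  by rewrite !(dist_sym conG z).
rewrite (IH x1 x2) //; last by lia.
have := dist_edge_le conG z x12; rewrite !(dist_sym conG y).
have := dist_edge_neq z x12; rewrite sedge_sym in x12.
by have := dist_edge_le conG z x12; lia.
Qed.

(** Move x one step toward y. If this moves away from z or w, then x is between y and that point and
    the triangle inequality concludes; otherwise both sides drop by one. *)
Lemma dist_four_point x y z w : dist x y + dist z w <=
  maxn (dist x z + dist y w) (dist x w + dist y z).
Proof.
move: {2}(dist x y) (erefl (dist x y)) => n; elim: n x => [|n IH] x xy.
  rewrite xy -(dist0_eq conG xy); have := dist_triangle conG z x w.
  rewrite (dist_sym conG z x); lia.
have [|x1 xx1 x1y] := dist_step conG (x := x) (y := y); first by rewrite xy.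
have := dist_triangle conG z x w; rewrite (dist_sym conG z x).
case: (ltnP (dist x z) (dist x1 z)) => [/(dist_away xx1 x1y)|lez].
  rewrite (dist_sym conG y x); lia.
case: (ltnP (dist x w) (dist x1 w)) => [/(dist_away xx1 x1y)|lew].
  have := dist_triangle conG z x w; rewrite !(dist_sym conG y x); lia.
have x1n : dist x1 y = n by lia.
have := IH x1 x1n; have := dist_edge_neq z xx1; have := dist_edge_neq w xx1.
have := dist_edge_le conG z xx1; have := dist_edge_le conG w xx1; lia.
Qed.

Lemma tree_dist : tree_metric (@dist G).
Proof.
split.
- move=> x y; apply/eqP/eqP=> [/(dist0_eq conG)//|->]; exact: dist_refl.
- exact: dist_sym.
- exact: dist_triangle.
- exact: dist_odd.
- exact: dist_four_point.
- by move=> x y n; apply: dist_prefix.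
Qed.

End Tree.

Lemma diameter_unique (V : finType) (d : V -> V -> nat) D D' :
  diameter d D -> diameter d D' -> D = D'.
Proof.
move=> [h [x [y xy]]] [h' [x' [y' xy']]].
by apply/eqP; rewrite eqn_leq -{1}xy -{2}xy' h h'.
Qed.

Lemma diameter_diam (G : sgraph) : 0 < #|G| -> diameter (@dist G) (diam G).
Proof.
move=> G0; split=> [x y|].
  apply: (leq_trans (leq_bigmax (F := fun y => dist x y) y)).
  exact: (leq_bigmax (F := @ecc G) x).
have [x hx] := eq_bigmax (@ecc G) G0; have [y hy] := eq_bigmax (@dist G x) G0.
by exists x, y; rewrite -hy -/(ecc x) -hx.
Qed.

Lemma tree_diam_gt0 (T : sgraph) : nontrivial_tree T -> 0 < diam T.
Proof.
move=> [tT T1]; have := diameter_diam (ltnW T1) => -[h _].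
have /card_gt1P[x [y [_ _ xy]]] := T1; apply: leq_trans (h x y).
by apply: (tm_neq (tree_dist tT)); apply/eqP.
Qed.

Lemma three_peripheralP (G : sgraph) : (forall x : G, dist x x = 0) -> 0 < diam G ->
  reflect (three_far (@dist G) (diam G)) (three_peripheral G).
Proof.
move=> d0 D0; apply: (iffP existsP) => [[x /existsP[y /existsP[z]]]|[x [y [z [h1 h2 h3]]]]].
  by case/and5P=> _ _ _ /eqP h1 /andP[/eqP h2 /eqP h3]; exists x, y, z.
have neq (u v : G) : dist u v = diam G -> u != v.
  by move=> uv; apply/eqP=> E; move: D0; rewrite -uv E d0.
exists x; apply/existsP; exists y; apply/existsP; exists z.
by rewrite !neq // h1 h2 h3 !eqxx.
Qed.

(** * Distances and rainbow progressions in the product *)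

Section Box.
Variables T U : sgraph.
Hypotheses (tT : tree T) (tU : tree U).

Lemma box_dist (p q : box T U) :
  connect (@sedge (box T U)) p q /\ dist p q = dist p.1 q.1 + dist p.2 q.2.
Proof.
have dT := tree_dist tT; have eT := tree_dist tU.
have [[_ cT] _] := tT; have [[_ cU] _] := tU.
pose f (p : box T U) := dist p.1 q.1 + dist p.2 q.2.
apply: (@dist_eq (box T U) f q) => {p} [|[a u]|[a u] [a' u']|[a u]]; rewrite /f /=.
- by rewrite (tm_refl dT) (tm_refl eT).
- case: q {f} => b v /= /eqP; rewrite addn_eq0 (tm_eq0 dT) (tm_eq0 eT).
  by case/andP=> /eqP -> /eqP ->.
- rewrite /sedge /= /box_rel /= => /orP[] /andP[/eqP -> h].
    by rewrite -addnS leq_add2l dist_edge_le.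
  by rewrite -addSn leq_add2r dist_edge_le.
- case: (posnP (dist a q.1)) => [a0|/(dist_step cT)[a' aa' h] _].
    rewrite a0 => /(dist_step cU)[u' uu' h]; exists (a, u'); rewrite /sedge /= /box_rel /=.
      by rewrite eqxx uu'.
    by rewrite a0 -h.
  exists (a', u); rewrite /sedge /= /box_rel /=; first by rewrite eqxx aa' orbT.
  by rewrite -h addSn.
Qed.

Lemma box_diam : diam (box T U) = diam T + diam U.
Proof.
have [[T0 _] _] := tT; have [[U0 _] _] := tU.
have [dT [a [a' aa']]] := diameter_diam T0; have [dU [u [u' uu']]] := diameter_diam U0.
have B0 : 0 < #|box T U| by rewrite card_prod muln_gt0 T0.
apply: (diameter_unique (diameter_diam B0)); split=> [p q|].
  by rewrite (box_dist p q).2 leq_add.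
by exists (a, u), (a', u'); rewrite (box_dist _ _).2 aa' uu'.
Qed.

Lemma has_rainbow_AP3P r (c : {ffun box T U -> 'I_r}) :
  reflect (exists x y z, dist x y = dist y z /\ uniq [:: c x; c y; c z])
          (has_rainbow_AP c 3).
Proof.
apply: (iffP existsP) => [[k /existsP[[[|x [|y [|z [|//]]]] //= s3]]]|[x [y [z [xyz u]]]]].
  case/andP=> /and3P[/eqP xy /eqP yz _] u; exists x, y, z; split=> //.
  by rewrite xy.
have B0 : 0 < #|box T U| by apply/card_gt0P; exists x.
have k : dist x y < (diam (box T U)).+1 by rewrite ltnS (diameter_diam B0).1.
exists (Ordinal k); apply/existsP; exists [tuple x; y; z].
by rewrite /is_AP /= eqxx xyz eqxx.
Qed.

Lemma rainbow_freeP r (c : {ffun box T U -> 'I_r}) : ~~ has_rainbow_AP c 3 <->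
  rainbow_free (@dist T) (@dist U) (fun a u => c (a, u)).
Proof.
split=> [no a u a' u' a'' u'' h /eqP n1 /eqP n2|rf].
  apply/eqP; apply: contraNT no => n3; apply/has_rainbow_AP3P.
  exists (a, u), (a', u'), (a'', u''); rewrite !(box_dist _ _).2 /= h.
  by rewrite !inE negb_or n1 n2 n3.
apply/has_rainbow_AP3P=> -[[a u] [[a' u'] [[a'' u'']]]].
rewrite !(box_dist _ _).2 /= !inE negb_or andbT => -[h /andP[/andP[n1 n2] n3]].
by case/eqP: n2; apply: (rf _ _ a' u') => //; apply/eqP.
Qed.

Lemma forces_rainbow3P r : 0 < r ->
  forces_rainbow (box T U) 3 r <->
  ~ exists2 c : T -> U -> 'I_r, rainbow_free (@dist T) (@dist U) c &
      forall i, exists a u, c a u = i.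
Proof.
move=> r0; rewrite /forces_rainbow r0 /=; split=> [/forallP h [c rf onto]|h].
  have /implyP f := h [ffun p : box T U => c p.1 p.2].
  have onto' : exact_coloring [ffun p : box T U => c p.1 p.2].
    apply/forallP=> i; have [a [u <-]] := onto i.
    by apply/existsP; exists (a, u); rewrite ffunE.
  have /negP : ~~ has_rainbow_AP [ffun p : box T U => c p.1 p.2] 3; last first.
    by apply; apply: f.
  apply: (proj2 (rainbow_freeP _)) => a u a' u' a'' u''.
  rewrite !ffunE; apply: rf.
apply/forallP=> c; apply/implyP=> /forallP onto; apply: contraT => /rainbow_freeP rf.
case: h; exists (fun a u => c (a, u)) => // i.
by have /existsP[[a u] /eqP <-] := onto i; exists a, u.
Qed.

Hypothesis T1 : 1 < #|T|.

Lemma forces_rainbow3_gt2 r : forces_rainbow (box T U) 3 r -> 2 < r.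
Proof.
move=> f; have r0 : 0 < r by case/andP: f.
rewrite ltnNge; apply/negP=> r2; case/forces_rainbow3P: f => //.
have [[/card_gt0P[u _] _] _] := tU; have /card_gt1P[x [y [_ _ /eqP xy]]] := T1.
case: r r0 r2 => [|[|[|]]] // _ _.
  by exists (fun _ _ => ord0) => // i; exists x, u; rewrite ord1.
exists (fun a _ => if a == x then ord0 else ord_max) => [a v a' v' a'' v'' _|].
  by case: ifP; case: ifP; case: ifP.
case=> [[|[|//]]] i.
  by exists x, u; rewrite eqxx; apply: val_inj.
by exists y, u; case: eqP => [/esym//|_]; apply: val_inj.
Qed.

Lemma aw3P : 0 < diam U -> aw (box T U) 3 = 3 \/ aw (box T U) 3 = 4.
Proof.
move=> U0; rewrite /aw; case: ex_minnP => m /forces_rainbow3_gt2 m2 min.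
have : m <= 4; last by lia.
apply: min; apply/forces_rainbow3P => // -[c rf onto].
have dT := diameter_diam (ltnW T1); have [[T0 _] _] := tU.
have D0 := tree_diam_gt0 (conj tT T1).
apply: (no_four_colors (tree_dist tT) dT D0 (tree_dist tU) (diameter_diam T0) U0 rf _ onto).
by rewrite card_ord.
Qed.

Lemma aw_eq3 : forces_rainbow (box T U) 3 3 -> aw (box T U) 3 = 3.
Proof.
rewrite /aw => f; case: ex_minnP => m /forces_rainbow3_gt2 m2 /(_ _ f) m3.
by apply/eqP; rewrite eqn_leq m3.
Qed.

Lemma aw_neq3 : ~ forces_rainbow (box T U) 3 3 -> aw (box T U) 3 <> 3.
Proof. by rewrite /aw => nf; case: ex_minnP => m f _ m3; rewrite m3 in f. Qed.

End Box.

(** * Trees of diameter one *)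

Lemma card_diam1 (T : sgraph) : tree T -> #|T| = 2 -> diam T = 1.
Proof.
move=> tT T2; have ntT : nontrivial_tree T by split; rewrite ?T2.
apply/eqP; rewrite eqn_leq (tree_diam_gt0 ntT) andbT.
have [[T0 cT] _] := tT; have [_ [x [y <-]]] := diameter_diam T0.
have [p [_ _ sp up]] := geodesic_path (cT x y).
by rewrite -sp -ltnS -[(size p).+1]/(size (x :: p)) -(card_uniqP up) -T2 max_card.
Qed.

Lemma iso_P2_card (T : sgraph) : isomorphic T (path_graph 2) -> #|T| = 2.
Proof. by case=> f /bij_eq_card -> _; rewrite card_ord. Qed.

Lemma diam1_iso_P2 (T : sgraph) : nontrivial_tree T -> diam T = 1 ->
  isomorphic T (path_graph 2).
Proof.
move=> [tT T1] D1; have [[T0 cT] acy] := tT; have dT := tree_dist tT.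
have [le _] := diameter_diam T0; rewrite D1 in le.
have edge (x y : T) : (x -- y) = (x != y).
  apply/idP/idP=> [xy|/eqP xy]; first by apply/eqP=> E; rewrite E sedge_irr in xy.
  have [z xz h] := dist_step cT (tm_neq dT xy).
  by have := le x y; rewrite -h ltnS leqn0 => /eqP/(dist0_eq cT) <-.
have /card_gt1P[x [y [_ _ xy]]] := T1.
(* All vertices are adjacent, so a third one would close a triangle. *)
have xyT z : (z == x) || (z == y).
  apply: contraT; rewrite negb_or => /andP[zx zy]; case: (acy [:: x; y; z]) => //.
  by rewrite /ucycle /= !edge !inE (negbTE xy) !(eq_sym _ z) (negbTE zx) (negbTE zy).
exists (fun z => if z == x then ord0 else ord_max : 'I_2) => [|z w].
  exists (fun i : 'I_2 => if i == ord0 then x else y) => [z|i] /=.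
    have [->//|zx] := eqVneq z x.
    by have := xyT z; rewrite (negbTE zx) /= => /eqP.
  have [->|i0] := eqVneq i ord0; first by rewrite eqxx.
  rewrite eq_sym (negbTE xy); apply: val_inj.
  by move: i0; rewrite -val_eqE /=; case: i => [[|[|]]].
rewrite edge /sedge /= /path_rel.
have := xyT z; have := xyT w; case: (z =P x) => [->|zx] /=; case: (w =P x) => [->|wx] /=.
- by rewrite eqxx.
- by move=> /eqP -> _; rewrite xy.
- by move=> _ /eqP ->; rewrite eq_sym xy.
- by move=> /eqP -> /eqP ->; rewrite eqxx.
Qed.

(** * Weakly non-3-peripheral trees *)

Section SpreadTight.
Variables (V : finType) (d : V -> V -> nat) (D : nat).
Hypotheses (dT : tree_metric d) (dm : forall x y, d x y <= D).

Lemma close_pair a b x y : d a b = D -> d a x < D -> d a y < D -> d x y < D.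
Proof.
move=> ab ax ay; have := tm_4pt dT x y a b; have := dm x b; have := dm y b.
tm_lia dT.
Qed.

(** Of any two among x, y, z, one is at distance D - 1 from a and the other is opposite to b; over
    the three pairs, some vertex plays both roles and serves as w. *)
Lemma spread_odd a b x y z : odd D -> 1 < D -> d a b = D ->
  d a x < D -> d a y < D -> d a z < D ->
  d x y + 1 = D -> d x z + 1 = D -> d y z + 1 = D -> spread d D a b.
Proof.
move=> o D1 ab ax ay az xy xz yz.
have [w [aw wb]] : exists w, d a w + 1 = D /\ d w b = D.
  have key u v : d a u < D -> d a v < D -> d u v + 1 = D ->
      (d a u + 1 = D /\ d v b = D) \/ (d a v + 1 = D /\ d u b = D).
    move=> au av uv; have := tm_4pt dT u v a b; have := dm u b; have := dm v b.
    tm_lia dT.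
  case: (key x y) => // -[h1 h2]; case: (key x z) => // -[h3 h4];
    case: (key y z) => // -[h5 h6]; try (by exists x); try (by exists y);
    by exists z.
(* z' is the neighbor of b toward w; D being odd, p can be one step closer to w than to b. *)
have [|z' wz z'b] := tm_mid dT (x := w) (y := b) (n := D - 1); first lia.
have [|p pb pw] := tm_mid dT (x := b) (y := w) (n := D.+1./2); first by tm_lia dT.
exists w, z', p; have := tm_4pt dT a p w b.
by split; [| |tm_lia dT|split]; tm_lia dT.
Qed.

(** Here u is where the leaf is attached. Parity and the absence of three far points put every end
    at distance D - 1 from u, so u serves as w and b as z, with p at distance D/2 from b on the way
    to u. *)
Lemma spread_even a b x y u : ~~ odd D -> 0 < D -> ~ three_far d D ->
  d x y = D -> d x u + 1 = D -> d y u + 1 = D -> d a b = D -> spread d D a b.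
Proof.
move=> o D0 no xy xu yu ab.
have end_ v x' y' : d x' y' = D -> d x' u + 1 = D -> d y' u + 1 = D ->
    d v x' = D -> d v u + 1 = D.
  move=> xy' xu' yu' vx; have vy : d v y' <> D by move=> vy; apply: no; exists v, x', y'.
  have vx' : d v x' = d y' x' by rewrite vx (tm_sym dT).
  have := tm_odd_eq dT y' vx'; have := tm_odd_eq dT u vx'; rewrite (tm_refl dT).
  have : D + d u y' <= maxn (d v u + D) (d v y' + d x' u).
    by rewrite -{1}vx -xy' tm_4pt.
  have := dm v y'; have := dm v u; rewrite (tm_sym dT u).
  by move: o xu' yu' vy; clear; lia.
have yx : d y x = D by rewrite (tm_sym dT).
have ends v w : d v w = D -> d v u + 1 = D.
  move=> vw; have [/(end_ v x y)|nx] := eqVneq (d v x) D; first exact.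
  apply: (end_ v y x) => //; have := tm_4pt dT v w x y.
  by have := dm v x; have := dm v y; have := dm w x; have := dm w y; tm_lia dT.
have au := ends _ _ ab; have bu : d b u + 1 = D by apply: (ends b a); rewrite (tm_sym dT).
have [|p pb pu] := tm_mid dT (x := b) (y := u) (n := D./2); first lia.
exists u, b, p; rewrite (tm_refl dT); have := tm_4pt dT a p u b.
by split; [| | |split]; tm_lia dT.
Qed.

Lemma tight_even a b : ~~ odd D -> ~ three_far d D -> d a b = D ->
  (forall x y u, d x y = D -> d x u + 1 = D -> d y u + 1 <> D) -> tight d D a b.
Proof.
move=> o nt ab no x xb; split.
  have xa : d x a <> D by move=> xa; apply: nt; exists x, a, b.
  by have := tm_odd dT x a b; have := dm x a; lia.
move=> y xy; have := no x b y xb xy; have := tm_odd dT x y b.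
by have := dm y b; tm_lia dT.
Qed.

Lemma tight_odd a b : odd D -> d a b = D ->
  (forall x, d a x + 1 = D -> d x b <> D) -> tight d D a b.
Proof.
move=> o ab no x xb.
have xa : d x a + 2 <= D.
  have : d a x + 1 <> D by move=> /no.
  have := tm_odd dT x a b; have := dm x a; tm_lia dT.
split=> // y xy; have yb : d y b <> D.
  move=> yb; have := tm_4pt dT x y a b; have := tm_odd dT y a b.
  have := dm y a; have : d a y + 1 <> D by move=> /no.
  tm_lia dT.
by have := tm_odd dT x y b; have := dm y b; lia.
Qed.

End SpreadTight.

(** * Deleting the farthest vertices and adding a leaf *)

Lemma induced_dist (T : sgraph) (P : pred T) : tree T ->
  (forall x y z, btw (@dist T) x y z -> P x -> P z -> P y) ->
  forall x y : induced P, connect (@sedge (induced P)) x y /\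
    dist x y = dist (val x) (val y).
Proof.
move=> tT cv x y; have dT := tree_dist tT; have [[_ cT] _] := tT.
apply: (@dist_eq (induced P) (fun x => dist (val x) (val y)) y) => {x}.
- exact: (tm_refl dT).
- by move=> x /(dist0_eq cT)/val_inj.
- by move=> x x' xx'; apply: dist_edge_le.
- move=> x /(dist_step cT)[x' xx' h].
  have Px' : P x'.
    apply: (cv (val x) x' (val y)); [|exact: valP..].
    have := dist_edge xx'; have := tm_tri dT (val x) x' (val y).
    rewrite /btw; lia.
  by exists (exist _ x' Px').
Qed.

Definition leaf_dist (T : sgraph) (u : T) (x y : option T) :=
  match x, y with
  | Some a, Some b => dist a b
  | Some a, None | None, Some a => (dist a u).+1
  | None, None => 0
  end.

Lemma add_leaf_dist (T : sgraph) (u : T) (x y : add_leaf u) : tree T ->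
  connect (@sedge (add_leaf u)) x y /\ dist x y = leaf_dist u x y.
Proof.
move=> tT; have dT := tree_dist tT; have [[_ cT] _] := tT.
apply: (@dist_eq (add_leaf u) (fun x => leaf_dist u x y) y) => {x}; case: y => [b|] //=.
- exact: (tm_refl dT).
- by case=> //= a /(dist0_eq cT) ->.
- by case.
- case=> [a|] [a'|] //=; rewrite /sedge /=; first exact: dist_edge_le.
    by move=> /eqP ->; rewrite (tm_sym dT b); lia.
  by move=> /eqP ->; rewrite (tm_sym dT b); lia.
- case=> [a|] [a'|] //=; rewrite /sedge /=; last by move=> /eqP ->; rewrite (tm_refl dT).
  by move=> /dist_edge_le h; rewrite ltnS h.
- case=> [a|] /=; last by exists (Some u); rewrite /sedge /= ?eqxx // (tm_sym dT).
  by move=> /(dist_step cT)[a' aa' h]; exists (Some a').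
- case=> [a|] //= _; case: (posnP (dist a u)) => [au|/(dist_step cT)[a' aa' h]].
    by exists None; rewrite /sedge /= ?au // (dist0_eq cT au).
  by exists (Some a'); rewrite //= h.
Qed.

Section Peripheral.
Variable T : sgraph.
Hypothesis ntT : nontrivial_tree T.
Let tT : tree T := proj1 ntT.
Let dT := tree_dist tT.
Let D := diam T.
Let D0 : 0 < D := tree_diam_gt0 ntT.
Let dD : diameter (@dist T) D := diameter_diam (ltnW (proj2 ntT)).

Lemma tree_three_peripheralP : reflect (three_far (@dist T) D) (three_peripheral T).
Proof. by apply: three_peripheralP => //; apply: (tm_refl dT). Qed.

Lemma peripheral_dist (v : T) : peripheral v <-> exists w, dist v w = D.
Proof.
split=> [/eqP|[w vw]].
  have [w h] := eq_bigmax (@dist T v) (ltnW (proj2 ntT)).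
  by exists w; rewrite -h.
rewrite /peripheral eqn_leq; apply/andP; split.
  exact: (leq_bigmax (F := @ecc T) v).
by rewrite -/D -vw; apply: (leq_bigmax (F := @dist T v) w).
Qed.

Section Delete.
Variables a b : T.
Hypothesis ab : dist a b = D.
Let H := delete_farthest a.

Lemma delete_farthest_lt (x : H) : dist a (val x) < D.
Proof. by have := valP x; have := dD.1 a (val x); rewrite /= -/D; lia. Qed.

Lemma delete_farthest_dist (x y : H) :
  connect (@sedge H) x y /\ dist x y = dist (val x) (val y).
Proof.
apply: induced_dist => // u v w; rewrite /btw /= -/D => uvw nu nw.
have := tm_4pt dT a v u w; have := dD.1 a u; have := dD.1 a v; have := dD.1 a w.
tm_lia dT.
Qed.

Lemma delete_farthest_vertex (x : T) : dist a x < D -> exists x' : H, val x' = x.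
Proof.
move=> ax; have Px : [pred u | dist a u != diam T] x by rewrite /= -/D; lia.
by exists (exist _ x Px).
Qed.

Lemma delete_farthest_diameter : diameter (@dist H) (D - 1).
Proof.
split=> [x y|].
  rewrite (delete_farthest_dist x y).2.
  have := close_pair dT dD.1 ab (delete_farthest_lt x) (delete_farthest_lt y); lia.
have [|c ac _] := tm_mid dT (x := a) (y := b) (n := D - 1); first lia.
have [|a' ea] := @delete_farthest_vertex a; first by rewrite (tm_refl dT).
have [|c' ec] := @delete_farthest_vertex c; first lia.
by exists a', c'; rewrite (delete_farthest_dist _ _).2 ea ec.
Qed.

Lemma delete_farthest_diam : diam H = D - 1.
Proof.
apply: (diameter_unique (diameter_diam _) delete_farthest_diameter).
by have [_ [x _]] := delete_farthest_diameter; apply/card_gt0P; exists x.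
Qed.

End Delete.

(** Three old vertices would make T 3-peripheral, so one of the triple is the leaf; the other two
    show that the diameter has not grown. *)
Lemma add_leaf_three_far (v : T) : ~ three_far (@dist T) D ->
  three_peripheral (add_leaf v) ->
  exists x y, [/\ dist x y = D, dist x v + 1 = D & dist y v + 1 = D].
Proof.
move=> no; set L := add_leaf v => tp.
have L0 : 0 < #|L| by apply/card_gt0P; exists None.
have leD : D <= diam L.
  have [_ [x [y <-]]] := dD.
  have : dist (Some x : L) (Some y) = dist x y := (add_leaf_dist (Some x : L) (Some y) tT).2.
  by move=> <-; apply: (diameter_diam L0).1.
have far (x y : T) : leaf_dist v (Some x) (Some y) = diam L -> dist x y = D /\ diam L = D.
  by move=> /= h; have := dD.1 x y; lia.
case/existsP: tp => x /existsP[y /existsP[z]].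
case/and5P=> xy xz yz /eqP + /andP[/eqP + /eqP +].
rewrite !(add_leaf_dist _ _ tT).2.
case: x xy xz => [x|]; case: y yz => [y|]; case: z => [z|] //= _ _ _.
- move=> /far[h1 _] /far[h2 _] /far[h3 _]; by case: no; exists x, y, z.
- by move=> /far[h1 ->] h2 h3; exists x, y; rewrite !addn1.
- by move=> h1 /far[h2 E] h3; rewrite E in h1 h3; exists x, z; rewrite !addn1.
- by move=> h1 h2 /far[h3 E]; rewrite E in h1 h2; exists y, z; rewrite !addn1.
Qed.

Lemma three_far_add_leaf (v x y : T) : dist x y = D -> dist x v + 1 = D ->
  dist y v + 1 = D -> three_peripheral (add_leaf v).
Proof.
move=> xy xv yv; set L := add_leaf v.
have L0 : 0 < #|L| by apply/card_gt0P; exists None.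
have dL (p q : L) : dist p q = leaf_dist v p q := (add_leaf_dist p q tT).2.
have DL : diam L = D.
  apply: (diameter_unique (diameter_diam L0)); split; last first.
    by exists (Some x), (Some y); rewrite dL.
  (* v is not peripheral, so the leaf does not enlarge the diameter. *)
  have vD w : dist w v < D.
    have := tm_4pt dT w v x y; have := dD.1 w x; have := dD.1 w y; have := dD.1 w v.
    tm_lia dT.
  by case=> [p|] [q|]; rewrite dL //=; apply: dD.1.
have xyn : x != y by apply/eqP=> E; move: D0; rewrite -xy E (tm_refl dT).
apply/existsP; exists (Some x); apply/existsP; exists (Some y); apply/existsP.
have nS : Some x != Some y :> L by apply: contraNneq xyn => -[->].
rewrite addn1 in xv; rewrite addn1 in yv.
by exists None; rewrite !dL DL /= xy xv yv !eqxx nS.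
Qed.

Lemma weakly_spread a b : weakly_non_three_peripheral T -> dist a b = D ->
  spread (@dist T) D a b.
Proof.
case=> _ /tree_three_peripheralP no; rewrite -/D; case: ifP => o w ab.
  have /existsP[x /existsP[y /existsP[z]]] : three_peripheral (delete_farthest a).
    by apply: w; apply/peripheral_dist; exists b.
  case/and5P=> nxy _ _ /eqP + /andP[/eqP + /eqP +].
  rewrite !(delete_farthest_dist ab _ _).2 (delete_farthest_diam ab) => xy xz yz.
  have : 0 < dist (val x) (val y) by apply: (tm_neq dT) => /val_inj E; rewrite E eqxx in nxy.
  rewrite xy subn_gt0 => D1.
  by apply: (spread_odd dT dD.1 o D1 ab (delete_farthest_lt ab x)
    (delete_farthest_lt ab y) (delete_farthest_lt ab z)); lia.
have [v /(add_leaf_three_far no)[x [y [xy xv yv]]]] := w.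
by apply: (spread_even dT dD.1 _ D0 no xy xv yv ab); rewrite o.
Qed.

Lemma not_weakly_tight : ~~ three_peripheral T -> ~ weakly_non_three_peripheral T ->
  D <> 1 -> exists a b, dist a b = D /\ tight (@dist T) D a b.
Proof.
move=> ntp nw D1; have /tree_three_peripheralP no := ntp.
case o : (odd D); last first.
  have [_ [a [b ab]]] := dD; exists a, b; split=> //.
  apply: (tight_even dT dD.1 _ no ab); first by rewrite o.
  move=> x y u xy xu yu; case: nw; split=> //; rewrite -/D o; exists u.
  exact: (three_far_add_leaf xy xu yu).
have /existsP[a] : [exists a : T, peripheral a && ~~ three_peripheral (delete_farthest a)].
  apply: contraT; rewrite negb_exists => /forallP h; case: nw; split=> //.
  by rewrite -/D o => v pv; have := h v; rewrite pv negbK.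
case/andP=> /peripheral_dist[b ab] nd; exists a, b; split=> //.
(* A violating x would be, with a and the neighbor z of b toward a, pairwise at distance D - 1 in
   the reduced tree. *)
apply: (tight_odd dT dD.1 o ab) => x ax xb; case/negP: nd.
have D2 : 1 < D by lia.
have [|z az zb] := tm_mid dT (x := a) (y := b) (n := D - 1); first lia.
have xz : dist x z = D - 1.
  have := tm_tri dT x z b; have := dD.1 x z; have := tm_odd dT x a z; tm_lia dT.
have [|a' ea] := delete_farthest_vertex ab (x := a); first by rewrite (tm_refl dT).
have [|x' ex] := delete_farthest_vertex ab (x := x); first lia.
have [|z' ez] := delete_farthest_vertex ab (x := z); first lia.
have dH := fun p q => (delete_farthest_dist ab p q).2.
have H0 (p : delete_farthest a) : dist p p = 0 by rewrite dH (tm_refl dT).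
have Hpos : 0 < diam (delete_farthest a) by rewrite (delete_farthest_diam ab); lia.
apply/(three_peripheralP H0 Hpos); rewrite (delete_farthest_diam ab).
by exists a', x', z'; rewrite !dH ea ex ez; split; lia.
Qed.

End Peripheral.

(** * Combining the upper and lower bounds *)

Lemma aw3_of_condition (T U : sgraph) : nontrivial_tree T -> nontrivial_tree U ->
  three_peripheral T \/
    ~~ odd (diam T + diam U) /\ (#|U| = 2 \/ weakly_non_three_peripheral T) ->
  ~ exists2 c : T -> U -> 'I_3, rainbow_free (@dist T) (@dist U) c &
      forall i, exists a u, c a u = i.
Proof.
move=> nT nU h [c rf onto].
have [tT T1] := nT; have [tU U1] := nU.
have dT := tree_dist tT; have eT := tree_dist tU.
have dD := diameter_diam (ltnW T1); have eE := diameter_diam (ltnW U1).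
have D0 := tree_diam_gt0 nT; have E0 := tree_diam_gt0 nU.
have c3 : three_colors c.
  have [a [u e0]] := onto ord0; have [a' [u' e1]] := onto (inord 1).
  have [a'' [u'' e2]] := onto ord_max; exists (a, u), (a', u'), (a'', u'').
  by rewrite /= e0 e1 e2; split=> /(congr1 val) /=; rewrite ?inordK.
case: h => [/(tree_three_peripheralP nT)|[o [U2|w]]].
- exact: (three_far_two_colors dT dD D0 eT eE E0 rf c3).
- exact: (diameter_neq1 dT dD D0 eT eE E0 rf c3 o (card_diam1 tU U2)).
- apply: (not_spread dT dD D0 eT eE E0 rf c3 o) => a b.
  exact: (weakly_spread nT w).
Qed.

Theorem corollary1p4 (T T' : sgraph)
    (hT : nontrivial_tree T) (hT' : nontrivial_tree T') :
  (aw3_condition T T' -> aw (box T T') 3 = 3) /\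
  (~ aw3_condition T T' -> aw (box T T') 3 = 4).
Proof.
have [tT T1] := hT; have [tU U1] := hT'.
have D0 := tree_diam_gt0 hT; have E0 := tree_diam_gt0 hT'.
rewrite /aw3_condition (box_diam tT tU); split=> [h|h].
  apply: aw_eq3 => //; apply/(forces_rainbow3P tT tU) => // ex.
  (* [aw3_of_condition] is one-sided, so the cases are sorted by which order of the factors it
     needs. *)
  have : (three_peripheral T \/ ~~ odd (diam T + diam T') /\
      (#|T'| = 2 \/ weakly_non_three_peripheral T)) \/
    (three_peripheral T' \/ ~~ odd (diam T' + diam T) /\
      (#|T| = 2 \/ weakly_non_three_peripheral T')).
    rewrite (addnC (diam T')).
    case: h => [|[o]|[o]] [] h; [left; left|right; left|right; right|left; right|
      left; right|right; right] => //; split=> //; try (by right);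
      by left; apply: iso_P2_card.
  case=> k; first exact: (aw3_of_condition hT hT' k ex).
  apply: (aw3_of_condition hT' hT k); case: ex => c rf onto.
  exists (fun u a => c a u); first exact: rainbow_free_swap.
  by move=> i; have [a [u <-]] := onto i; exists u, a.
have [aw3|//] := aw3P tT tU T1 E0.
case: (aw_neq3 _ aw3) => f; apply: (proj1 (forces_rainbow3P tT tU (r := 3) isT) f).
have n1 : ~~ three_peripheral T by apply/negP=> k; apply: h; constructor 1; left.
have n2 : ~~ three_peripheral T' by apply/negP=> k; apply: h; constructor 1; right.
have dT := tree_dist tT; have eT := tree_dist tU.
have dD := diameter_diam (ltnW T1); have eE := diameter_diam (ltnW U1).
have [o|o] := boolP (odd (diam T + diam T')).
  by apply: (coloring_odd dT dD D0 eT eE E0 o); [move/tree_three_peripheralP: n1; exact|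
    move/tree_three_peripheralP: n2; exact].
have [||a [b [ab tab]]] := not_weakly_tight hT n1.
- by move=> w; apply: h; constructor 3; split=> //; left.
- by move=> /(diam1_iso_P2 hT) i; apply: h; constructor 2; split=> //; left.
have [||v [w [vw tvw]]] := not_weakly_tight hT' n2.
- by move=> w; apply: h; constructor 3; split=> //; right.
- by move=> /(diam1_iso_P2 hT') i; apply: h; constructor 2; split=> //; right.
exact: (coloring_even dT dD D0 eT eE E0 ab vw o tab tvw).
Qed.
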